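(* Let $n \geq 1$ be an integer. For every real $p > 0$ and every $T_n \in \mathcal{T}_n^c$ we have $$\|T_n'\|_p \leq n\,\|T_n\|_p .$$
   Context: $\mathcal{T}_n^c$ denotes the collection of all trigonometric polynomials $T_n$ of the form $T_n(z) = \sum_{j=-n}^{n} a_j z^j$, with $a_j \in \mathbb{C}$ and $z \in \mathbb{C}\setminus\{0\}$. $T_n'$ denotes the derivative of $T_n$ with respect to the complex variable $z$. For a bounded measurable function $Q$ on the unit circle of the complex plane and real $p > 0$, $$\|Q\|_p = M_p(Q) := \left(\frac{1}{2\pi}\int_0^{2\pi} |Q(e^{it})|^p\,dt\right)^{1/p}.$$ *)

(* Defs.v *)
From HB Require Import structures.
From mathcomp Require Import all_boot all_order all_algebra.
From mathcomp Require Import complex.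
From mathcomp Require Import all_classical all_reals all_analysis.

Set Implicit Arguments.
Unset Strict Implicit.
Unset Printing Implicit Defensive.

Import Order.TTheory GRing.Theory Num.Theory.
Import numFieldNormedType.Exports.
Local Open Scope ring_scope.
Local Open Scope classical_set_scope.

Definition expi (R : realType) (t : R) : R[i] := Complex (cos t) (sin t).

(* Elements are functions on C \ {0}, so the (total) function T is
   unconstrained at 0. The exponent j in [-n, n] is k - n for 0 <= k <= 2n, and
   ^ is integer exponentiation. *)
Definition trig_poly (R : realType) (n : nat) : set (R[i] -> R[i]) :=
  [set T | exists a : int -> R[i], forall z : R[i], z != 0 ->
     T z = \sum_(k < (2 * n).+1) a (k%:Z - n%:Z) * z ^ (k%:Z - n%:Z)].

(* derive1 over the field R[i] is the complex derivative, the limit of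
   h^-1 * (T (h + z) - T z) as h tends to 0 in R[i] \ {0}. *)
Definition cderiv (R : realType) (T : R[i] -> R[i]) : R[i] -> R[i] :=
  derive1 (T : R[i] -> R[i]^o).

(* The integral is the extended-real Lebesgue integral, which is finite for
   bounded measurable Q; normc is the modulus with values in R. *)
Definition Mp (R : realType) (p : R) (Q : R[i] -> R[i]) : \bar R :=
  (((2 * pi)^-1%R%:E *
    \int[lebesgue_measure]_(t in `[0%R, (2 * pi)%R])
      (ComplexField.Normc.normc (Q (expi t)) `^ p)%:E) `^ p^-1)%E.

(* Main.v *)
Require Import Defs.
From HB Require Import structures.
From mathcomp Require Import all_boot all_order all_algebra.
From mathcomp Require Import complex.
From mathcomp Require Import all_classical all_reals all_analysis.
From mathcomp Require Import measurable_realfun.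
From mathcomp Require Import ring lra.
Import Order.TTheory GRing.Theory Num.Theory.
Import numFieldNormedType.Exports.
Local Open Scope ring_scope.
Local Open Scope classical_set_scope.
Import ComplexField.Normc.
Set Implicit Arguments.
Unset Strict Implicit.
Unset Printing Implicit Defensive.

(** Write T z = z^-n q(z) with q a polynomial of degree at most m = 2n.  On the
    unit circle |T| = |q| and |T'| = |z q' - n q| = n |L q|, where
    L q = m^-1 (2 z q' - m q), so the claim is that the integral of |L q|^p over
    the circle is at most that of |q|^p.  For p < 1 no convexity of t |-> t^p is
    available; the proof, due to Arestov, derives all p > 0 from the logarithmic
    mean, in three steps.

    Logarithmic mean ([mahler_polar]): the mean of log |L q| is at most that of
    log |q|.  Factor q, up to a constant, into m linear forms u z + v, a missing
    degree counting as the form 0 z + 1.  By Jensen's formula ([jensen_linear])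
    such a form has logarithmic mean log (max |u| |v|).  On the circle
    L q / q = m^-1 \sum (u z - v) / (u z + v), and replacing u z + v by
    conj v z + conj u leaves |u z + v| unchanged there and only reverses the sign
    of the real part of the summand.  Making all real parts nonnegative, that is
    moving all roots into the closed disc, therefore increases |L q| and keeps
    |q| ([normc_polar_linprod_flip]).  Once the roots are there, outside the disc
    the summands have positive real part, so the roots of L q lie in the closed
    disc as well ([polar_linprod_root_le1]); q and L q have the same leading
    coefficient, so by Jensen they have the same logarithmic mean.

    Positive part ([circle_logp_polar]): L fixes z^m, so the first step applied to
    q + w z^m with |w| = 1 compares L q + w z^m with q + w z^m.  The mean of
    log |a + w| over |w| = 1 is log (max 1 |a|), by Jensen again; integrating over
    w and exchanging the integrals gives the inequality for log (max 1 |.|).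

    Powers ([circle_powR_polar]): for 0 <= u <= 1 the integral over x >= 0 of
    exp (- p x) log (max 1 (exp x u)) is u^p / p^2 ([layer_cake]), so the second
    step, applied to all multiples of q, gives the inequality for u^p.

    The logarithms that occur are singular.  They enter as - log of a quantity
    that is at most 1, with value +oo at 0: all integrands are then nonnegative,
    and neither additivity nor Tonelli's theorem needs integrability. *)

Local Notation Re := complex.Re.
Local Notation Im := complex.Im.
Local Notation circle := (`[0, (2 * pi)]%classic).

(** * The modulus and the unit circle *)

Lemma normc_leD (R : realType) (x y : R[i]) :
  normc (x + y) <= normc x + normc y.
Proof. exact: le_normcD. Qed.

Lemma normc_opp (R : realType) (x : R[i]) : normc (- x) = normc x.
Proof. exact: normcN. Qed.

Lemma normc_leB (R : realType) (x y : R[i]) :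
  normc x - normc y <= normc (x - y).
Proof.
by rewrite lerBlDr; apply: le_trans (normc_leD _ _); rewrite subrK.
Qed.

Lemma normc_ge0 (R : realType) (x : R[i]) : 0 <= normc x.
Proof. by case: x => a b; exact: sqrtr_ge0. Qed.

Lemma normc_eq0 (R : realType) (x : R[i]) : (normc x == 0) = (x == 0).
Proof.
by apply/eqP/eqP => [/eq0_normc//|->]; exact: normc0.
Qed.

Lemma normc_gt0 (R : realType) (x : R[i]) : (0 < normc x) = (x != 0).
Proof. by rewrite lt_def normc_ge0 andbT normc_eq0. Qed.

Lemma normcX (R : realType) (x : R[i]) k : normc (x ^+ k) = normc x ^+ k.
Proof.
by elim: k => [|k ih]; [exact: normc1 | rewrite !exprS normcM ih].
Qed.

Lemma normc_conj (R : realType) (x : R[i]) : normc (conjc x) = normc x.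
Proof. by case: x => a b /=; rewrite sqrrN. Qed.

Lemma sqr_normcE (R : realType) (x : R[i]) :
  normc x ^+ 2 = Re x ^+ 2 + Im x ^+ 2.
Proof. by case: x => a b /=; rewrite sqr_sqrtr// addr_ge0// sqr_ge0. Qed.

Lemma normc_expi (R : realType) (t : R) : normc (expi t) = 1.
Proof. by rewrite /expi /= cos2Dsin2 sqrtr1. Qed.

Lemma expiD (R : realType) (s t : R) : expi (s + t) = expi s * expi t.
Proof.
by rewrite /expi cosD sinD; apply/eqP; rewrite eq_complex/= !eqxx/= addrC.
Qed.

Lemma expi0 (R : realType) : expi (0 : R) = 1.
Proof. by rewrite /expi cos0 sin0. Qed.

Lemma expi_pi (R : realType) : expi (pi : R) = -1.
Proof.
by rewrite /expi cospi sinpi; apply/eqP; rewrite eq_complex/= oppr0 !eqxx.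
Qed.

Lemma expiMn (R : realType) (t : R) k : expi (t *+ k) = expi t ^+ k.
Proof.
elim: k => [|k ih]; first by rewrite mulr0n expr0 expi0.
by rewrite mulrS exprS expiD ih.
Qed.

Lemma expi2pi (R : realType) : expi (2 * pi : R) = 1.
Proof. by rewrite mulr_natl expiMn expi_pi sqrrN expr1n. Qed.

Lemma expi_neq0 (R : realType) (t : R) : expi t != 0.
Proof. by rewrite -normc_gt0 normc_expi ltr01. Qed.

Lemma pi2_gt0 (R : realType) : 0 < 2 * pi :> R.
Proof. by rewrite mulr_gt0// pi_gt0. Qed.

Lemma continuous_Re_Im_horner (R : realType) (q : {poly R[i]}) :
  continuous (fun t : R => Re q.[expi t]) /\
  continuous (fun t : R => Im q.[expi t]).
Proof.
elim/poly_ind: q => [|q c [ihr ihi]].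
  by split => t; under eq_fun do rewrite horner0; exact: cvg_cst.
have hE t : (q * 'X + c%:P).[expi t] = q.[expi t] * expi t + c.
  by rewrite !hornerE.
split.
  have -> : (fun t : R => Re (q * 'X + c%:P).[expi t]) =
    (fun t => Re q.[expi t] * cos t - Im q.[expi t] * sin t + Re c).
    by apply/funext => t; rewrite hE /expi; case: (q.[_]) => x y; case: c {hE}.
  move=> t; apply: cvgD; last exact: cvg_cst.
  by apply: cvgB; apply: cvgM; [exact: ihr|exact: continuous_cos|
                                exact: ihi|exact: continuous_sin].
have -> : (fun t : R => Im (q * 'X + c%:P).[expi t]) =
  (fun t => Re q.[expi t] * sin t + Im q.[expi t] * cos t + Im c).
  by apply/funext => t; rewrite hE /expi; case: (q.[_]) => x y; case: c {hE}.
move=> t; apply: cvgD; last exact: cvg_cst.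
by apply: cvgD; apply: cvgM; [exact: ihr|exact: continuous_sin|
                              exact: ihi|exact: continuous_cos].
Qed.

Lemma continuous_normc_horner (R : realType) (q : {poly R[i]}) :
  continuous (fun t : R => normc q.[expi t]).
Proof.
have [cr ci] := continuous_Re_Im_horner q.
pose sq t := Re q.[expi t] * Re q.[expi t] + Im q.[expi t] * Im q.[expi t].
rewrite (_ : (fun _ => _) = (fun t => Num.sqrt (sq t))).
  move=> t; apply: (@continuous_comp _ _ _ sq Num.sqrt).
    by apply: cvgD; apply: cvgM; (exact: cr || exact: ci).
  exact: sqrt_continuous.
by apply/funext => t; rewrite /sq; case: (q.[_]) => x y; rewrite /= -!expr2.
Qed.

Section periodic_translation.
Context {R : realType}.
Local Notation mu := (@lebesgue_measure R).

Lemma continuous_itv_integrable (g : R -> R) (a b : R) :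
  continuous g -> mu.-integrable `[a, b] (EFin \o g).
Proof.
move=> cg; apply: continuous_compact_integrable; first exact: segment_compact.
exact: continuous_subspaceT.
Qed.

Lemma Rintegral_shift (g : R -> R) (a b c : R) : a <= b -> continuous g ->
  \int[mu]_(x in `[(a + c), (b + c)]) g x = \int[mu]_(x in `[a, b]) g (x + c).
Proof.
move=> ab cg; rewrite /Rintegral.
have dF : (fun x : R => x + c)^`() = cst 1.
  by apply/funext => x; rewrite derive1E deriveD// derive_id derive_cst addr0.
rewrite (@integration_by_substitution_increasing _ (fun x => x + c) g a b)//.
- congr fine; apply: eq_integral => x _; rewrite dF.
  by rewrite fctE mulr1.
- by move=> x y _ _; rewrite ltrD2r.
- by rewrite dF => x _; exact: cvg_cst.
- by rewrite dF; exact: is_cvg_cst.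
- by rewrite dF; exact: is_cvg_cst.
- have cF : continuous (fun x : R => x + c).
    by move=> x; apply: cvgD; [exact: cvg_id|exact: cvg_cst].
  split.
  + by move=> x _; apply: derivableD.
  + by apply: cvg_at_right_filter; exact: cF.
  + by apply: cvg_at_left_filter; exact: cF.
- exact: continuous_subspaceT.
Qed.

Lemma Rintegral_itv_split (g : R -> R) (a b c : R) : a <= b -> b <= c ->
  continuous g ->
  \int[mu]_(x in `[a, c]) g x =
  \int[mu]_(x in `[a, b]) g x + \int[mu]_(x in `[b, c]) g x.
Proof.
move=> ab bc cg.
have ic u v := continuous_itv_integrable u v cg.
have := @Rintegral_itvB _ g (BLeft a) (BRight c) b (ic a c).
rewrite !bnd_simp ab bc => /(_ isT isT) H.
rewrite -[X in _ + X]Rintegral_itv_obnd_cbnd; last first.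
  apply: integrableS (ic b c) => //.
  by move=> x /=; rewrite !in_itv/= => /andP[/ltW -> ->].
by rewrite -H addrCA subrr addr0.
Qed.

Lemma Rintegral_periodic_shift (g : R -> R) (T c : R) : 0 <= c -> c <= T ->
  (forall x, g (x + T) = g x) -> continuous g ->
  \int[mu]_(x in `[0, T]) g (x + c) = \int[mu]_(x in `[0, T]) g x.
Proof.
move=> c0 cT pg cg; rewrite -Rintegral_shift ?(le_trans c0)//.
rewrite add0r (@Rintegral_itv_split g c T (T + c))// ?lerDl//.
rewrite -[X in `[X, (T + c)]]add0r [T + c]addrC Rintegral_shift//.
rewrite [X in _ + X](_ : _ = \int[mu]_(x in `[0, c]) g x); last first.
  by apply: eq_Rintegral => x _; rewrite pg.
by rewrite addrC -Rintegral_itv_split.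
Qed.

End periodic_translation.

(** * Mean of log |z - b| for b inside the circle *)

Lemma expi_dyadic_shift (R : realType) (t : R) k :
  expi (t + pi / (2 ^ k)%:R) ^+ (2 ^ k) = - expi t ^+ (2 ^ k).
Proof.
rewrite expiD exprMn -[X in _ * X]expiMn.
rewrite -(mulr_natr (pi / _)) divfK ?pnatr_eq0 -?lt0n ?expn_gt0//.
by rewrite expi_pi mulrN1.
Qed.

(** The two translates g t and g (t + c) have the same integral over a period;
    with G their sum, this passes from the integral of g to that of G. *)
Lemma Rintegral_periodic_double (R : realType) (g G : R -> R) (T c : R) :
  0 <= c -> c <= T -> (forall x, g (x + T) = g x) -> continuous g ->
  (forall t, G t = g t + g (t + c)) ->
  \int[lebesgue_measure]_(t in `[0, T]) G t =
  2 * \int[lebesgue_measure]_(t in `[0, T]) g t.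
Proof.
move=> c0 cT pg cg GE; under eq_Rintegral do rewrite GE.
have cs : continuous (fun t => g (t + c)).
  move=> t; apply: (@continuous_comp _ _ _ (fun t => t + c) g); last exact: cg.
  by apply: cvgD; [exact: cvg_id|exact: cvg_cst].
rewrite RintegralD ?Rintegral_periodic_shift//.
- by rewrite mulr_natl mulr2n.
- exact: continuous_itv_integrable.
- exact: continuous_itv_integrable.
Qed.

Lemma continuous_ln_normc_horner (R : realType) (q : {poly R[i]}) :
  (forall t, q.[expi t] != 0) ->
  continuous (fun t : R => ln (normc q.[expi t])).
Proof.
move=> q0 t.
apply: (@continuous_comp _ _ _ (fun t => normc q.[expi t]) (@ln R)).
  exact: continuous_normc_horner.
by apply: continuous_ln; rewrite normc_gt0.
Qed.

Lemma circle_measure (R : realType) :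
  lebesgue_measure (`[0, (2 * pi)]%classic : set R) = (2 * pi)%:E.
Proof. by rewrite lebesgue_measure_itv/= lte_fin pi2_gt0 oppr0 adde0. Qed.

(** With N = 2^k and h_k t = log |e^(i N t) - b^N|, the factorization
    X^2 - B^2 = (X - B) (X + B) reads h_(k+1) t = h_k t + h_k (t + pi / N).  Hence
    the integral of h_0 is 2^-k times that of h_k, and the h_k are uniformly
    bounded as |b| < 1. *)
Lemma Rintegral_ln_expi_sub (R : realType) (b : R[i]) : normc b < 1 ->
  \int[lebesgue_measure]_(t in `[0, (2 * pi)]) ln (normc (expi t - b)) = 0.
Proof.
move=> b1; set mu := lebesgue_measure; set D := `[0, (2 * pi)]%classic.
pose h k t := ln (normc (expi t ^+ (2 ^ k) - b ^+ (2 ^ k))).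
have bX k : normc (b ^+ (2 ^ k)) <= normc b.
  rewrite normcX -[leRHS]expr1; apply: ler_wiXn2l; rewrite ?normc_ge0//.
    exact: ltW.
  by rewrite expn_gt0.
have lo k t : 1 - normc b <= normc (expi t ^+ (2 ^ k) - b ^+ (2 ^ k)).
  apply: le_trans (normc_leB _ _).
  by rewrite normcX normc_expi expr1n lerB.
have hi k t : normc (expi t ^+ (2 ^ k) - b ^+ (2 ^ k)) <= 2.
  apply: le_trans (normc_leD _ _) _.
  rewrite normc_opp normcX normc_expi expr1n -[leRHS]/(1 + 1) lerD2l.
  exact: le_trans (bX k) (ltW b1).
have gt0 k t : 0 < normc (expi t ^+ (2 ^ k) - b ^+ (2 ^ k)).
  by apply: lt_le_trans (lo k t); rewrite subr_gt0.
have ch k : continuous (h k).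
  rewrite /h; have hE t : expi t ^+ (2 ^ k) - b ^+ (2 ^ k) =
     ('X^(2 ^ k) - (b ^+ (2 ^ k))%:P).[expi t] by rewrite !hornerE.
  under eq_fun do rewrite hE; apply: continuous_ln_normc_horner => t.
  by rewrite -hE -normc_gt0.
have ich k := continuous_itv_integrable 0 (2 * pi) (ch k).
have mD : measurable (D : set (measurableTypeR R)) by exact: measurable_itv.
have halve k : \int[mu]_(t in D) h k t = 2^-1 * \int[mu]_(t in D) h k.+1 t.
  have N0 : 0 < (2 ^ k)%:R :> R by rewrite ltr0n expn_gt0.
  have pN : pi / (2 ^ k)%:R <= 2 * pi :> R.
    rewrite ler_pdivrMr// mulrAC ler_peMl ?pi_ge0//.
    by rewrite -natrM ler1n muln_gt0 expn_gt0.
  rewrite (@Rintegral_periodic_double _ (h k) (h k.+1) (2 * pi)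
    (pi / (2 ^ k)%:R)).
  - by rewrite mulKf// pnatr_eq0.
  - by apply: divr_ge0; [exact: pi_ge0|exact: ltW].
  - exact: pN.
  - by move=> t; rewrite /h expiD expi2pi mulr1.
  - exact: ch.
  - move=> t; rewrite /h (expi_dyadic_shift t k) -opprD normc_opp.
    rewrite -(lnM (gt0 k t)); last first.
      have := gt0 k (t + pi / (2 ^ k)%:R).
      by rewrite (expi_dyadic_shift t k) -opprD normc_opp.
    by rewrite -normcM -subr_sqr expnSr !exprM.
have halves k : \int[mu]_(t in D) h 0%N t = 2^-1 ^+ k * \int[mu]_(t in D) h k t.
  by elim: k => [|k ->]; rewrite ?expr0 ?mul1r// halve mulrA exprSr.
(* a bound on |h_k| for all k, as 1 - |b| <= |e^(i N t) - b^N| <= 2 *)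
pose B := Num.max (ln 2) (- ln (1 - normc b)).
have hB k t : `|h k t| <= B.
  rewrite ler_norml /B; apply/andP; split.
    rewrite lerNl le_max; apply/orP; right; rewrite lerN2 /h.
    by rewrite ler_ln ?posrE ?subr_gt0.
  by rewrite le_max; apply/orP; left; rewrite /h ler_ln ?posrE.
have IB k : `|\int[mu]_(t in D) h k t| <= B * (2 * pi).
  apply: le_trans (le_normr_Rintegral mD (ich k)) _.
  have -> : B * (2 * pi) = \int[mu]_(t in D) (cst B t).
    rewrite Rintegral_cst//; congr (_ * _).
    by rewrite [X in fine X](circle_measure R).
  apply: le_Rintegral => //.
    apply: (@continuous_itv_integrable _ (fun t => `|h k t|)) => t.
    by apply: cvg_norm; exact: ch.
  by apply: continuous_itv_integrable => t; exact: cvg_cst.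
have key k : `|\int[mu]_(t in D) h 0%N t| <= 2^-1 ^+ k * (B * (2 * pi)).
  rewrite (halves k) normrM ger0_norm ?exprn_ge0 ?invr_ge0//.
  by apply: ler_wpM2l => //; rewrite exprn_ge0// invr_ge0.
have -> : \int[mu]_(t in D) ln (normc (expi t - b)) = \int[mu]_(t in D) h 0%N t.
  by apply: eq_Rintegral => t _; rewrite /h !expr1.
apply/eqP; rewrite -normr_le0.
have cv : (2^-1 ^+ k * (B * (2 * pi)) @[k --> \oo]) --> (0 : R).
  rewrite -[X in _ --> X](mul0r (B * (2 * pi))).
  apply: cvgMl; apply: cvg_expr.
  by rewrite ger0_norm ?invr_ge0// invf_lt1// ltr1n.
rewrite -(cvg_lim _ cv)//; apply: limr_ge.
  by apply/cvg_ex; eexists; exact: cv.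
by near=> k; exact: key.
Unshelve. all: by end_near.
Qed.

(** * The ereal-valued function - log *)

(** Extended-real valued so that a root on the circle gives the value +oo instead
    of the default value of [ln] at 0; this makes [nlogM] hold at 0 too. *)
Definition nlog (R : realType) (x : R) : \bar R := (- lne x%:E)%E.

Section nlog.
Context {R : realType}.
Implicit Types x y : R.

Lemma nlog0 : nlog (0 : R) = +oo%E.
Proof. by rewrite /nlog/= lexx. Qed.

Lemma nlogE x : 0 < x -> nlog x = (- ln x)%:E.
Proof. by move=> x0; rewrite /nlog lne_EFin. Qed.

Lemma nlog_ge0 x : x <= 1 -> (0 <= nlog x)%E.
Proof.
by move=> x1; rewrite /nlog oppe_ge0 lne_le0 lee_fin.
Qed.

Lemma nlogM x y : 0 <= x -> 0 <= y -> nlog (x * y) = (nlog x + nlog y)%E.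
Proof.
rewrite le_eqVlt => /predU1P[<- |x0].
  rewrite mul0r nlog0 le_eqVlt => /predU1P[<- |y0]; first by rewrite nlog0.
  by rewrite nlogE.
rewrite le_eqVlt => /predU1P[<- |y0]; first by rewrite mulr0 nlog0 nlogE.
by rewrite !nlogE ?mulr_gt0// lnM// opprD EFinD.
Qed.

Lemma nlog_le x y : 0 <= x -> x <= y -> (nlog y <= nlog x)%E.
Proof.
rewrite le_eqVlt => /predU1P[<- _|x0 xy]; first by rewrite nlog0 leey.
have y0 := lt_le_trans x0 xy.
by rewrite !nlogE// lee_fin lerN2 ler_ln.
Qed.

Lemma measurable_nlog : measurable_fun [set: R] (@nlog R).
Proof.
rewrite (_ : @nlog R = fun x => if x <= 0 then +oo%E else (- ln x)%:E).
  apply: measurable_fun_ifT; [|exact: measurable_cst|].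
    by apply: measurable_fun_ler; [exact: measurable_id|exact: measurable_cst].
  by apply/measurable_EFinP; exact: measurableT_comp.
by apply/funext => x; rewrite /nlog/=; case: ifPn.
Qed.

Lemma cvg_nlog (u : nat -> R) (l : R) : (forall n, 0 < u n) -> 0 <= l ->
  u @ \oo --> l -> nlog (u n) @[n --> \oo] --> nlog l.
Proof.
move=> u0; rewrite le_eqVlt => /predU1P[<- ul|l0 ul].
  rewrite nlog0; under eq_fun do rewrite nlogE//.
  apply/cvgeryP; apply/(@cvgNry _ _ \oo _ (fun n => ln (u n))).
  apply: (@cvg_comp _ _ _ u (@ln R) \oo (0^'+)); last exact: lnNy.
  move=> A [e /= e0 eA].
  have une : \forall n \near \oo, u n < e by exact: (cvgr_lt _ ul).
  change (\forall n \near \oo, A (u n)).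
  apply: filterS une => n une.
  by apply: eA => //=; rewrite sub0r normrN gtr0_norm.
rewrite nlogE//; under eq_fun do rewrite nlogE//.
have lnu : ln (u n) @[n --> \oo] --> ln l.
  apply: (@cvg_comp _ _ _ u (@ln R) \oo (nbhs l)) => //.
  exact: continuous_ln.
apply: cvg_EFin; first by near=> n.
exact: (cvgN lnu).
Unshelve. all: by end_near.
Qed.

End nlog.


Lemma measurable_circle (R : realType) :
  measurable (circle : set (measurableTypeR R)).
Proof. exact: measurable_itv. Qed.

Section circle_integrals.
Context {R : realType}.
Local Notation mu := (@lebesgue_measure R).

(** Additivity against a constant of either sign, for f that need not be
    integrable: a negative constant is moved to the side of g. *)
Lemma circle_integral_shift (r : R) (f g : R -> \bar R) :
  (forall t, circle t -> (0 <= f t)%E) ->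
  (forall t, circle t -> (0 <= g t)%E) ->
  measurable_fun circle f -> measurable_fun circle g ->
  (forall t, circle t -> (g t = r%:E + f t)%E) ->
  (\int[mu]_(t in circle) g t = (2 * pi * r)%:E + \int[mu]_(t in circle) f t)%E.
Proof.
move=> f0 g0 mf mg gf.
have mD := @measurable_circle R.
have cstE (c : R) : (\int[mu]_(t in circle) (cst c%:E t) = (2 * pi * c)%:E)%E.
  rewrite integral_cst//; transitivity (c%:E * (2 * pi)%:E)%E.
    by congr (_ * _)%E; exact: circle_measure.
  by rewrite -EFinM mulrC.
have [r0|/ltW r0] := leP 0 r.
  rewrite -cstE -ge0_integralD//.
  by apply: eq_integral => t; rewrite inE => /gf ->.
have -> : (\int[mu]_(t in circle) f t =
    \int[mu]_(t in circle) (cst (- r)%:E t + g t))%E.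
  apply: eq_integral => t; rewrite inE => /gf ->.
  by rewrite addeA -EFinD addNr add0e.
rewrite ge0_integralD//; last by move=> t _; rewrite lee_fin oppr_ge0.
by rewrite cstE addeA -EFinD mulrN subrr add0e.
Qed.

Lemma measurable_nlog_horner (k : R) (q : {poly R[i]}) (D : set R) :
  measurable_fun D (fun t : R => nlog (k * normc q.[expi t])).
Proof.
apply: measurable_funTS.
apply: (measurableT_comp (f := @nlog R)); first exact: measurable_nlog.
apply: measurable_funM => //.
by apply: continuous_measurable_fun; exact: continuous_normc_horner.
Qed.

End circle_integrals.

(** * Jensen's formula for one linear factor *)

Section jensen.
Context {R : realType}.
Local Notation mu := (@lebesgue_measure R).
Implicit Types b : R[i].

Lemma measurable_nlog_sub (k : R) b (D : set R) :
  measurable_fun D (fun t : R => nlog (k * normc (expi t - b))).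
Proof.
have hE t : expi t - b = ('X - b%:P).[expi t] by rewrite !hornerE.
by under eq_fun do rewrite hE; exact: measurable_nlog_horner.
Qed.

(** The factor 1/3 keeps the argument of [nlog] at most 1: |e^(it) - b| <= 2, and
    the perturbed moduli in the proof of [jensen_circle] are at most 3. *)
Lemma jensen_open_disc b : normc b < 1 ->
  (\int[mu]_(t in circle) nlog (3^-1 * normc (expi t - b))%R =
   (2 * pi * ln 3)%R%:E)%E.
Proof.
move=> b1.
have hE t : expi t - b = ('X - b%:P).[expi t] by rewrite !hornerE.
have gt0 t : 0 < normc (expi t - b).
  apply: lt_le_trans (normc_leB _ _).
  by rewrite normc_expi subr_gt0.
have cl : continuous (fun t : R => ln (normc (expi t - b))).
  under eq_fun do rewrite hE; apply: continuous_ln_normc_horner => t.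
  by rewrite -hE -normc_gt0.
have cg : continuous (fun t : R => ln 3 - ln (normc (expi t - b))).
  by move=> t; apply: cvgB; [exact: cvg_cst|exact: cl].
have mD := @measurable_circle R.
pose g t := ln 3 - ln (normc (expi t - b)).
transitivity (\int[mu]_(t in circle) (g t)%:E)%E.
  apply: eq_integral => t _; rewrite nlogE ?mulr_gt0 ?invr_gt0//.
  by rewrite lnM ?posrE ?invr_gt0// lnV ?posrE// opprD opprK.
rewrite -[LHS]fineK; last first.
  apply: integrable_fin_num => //.
  exact: (@continuous_itv_integrable _ _ 0 (2 * pi) cg).
congr (_%:E); rewrite -/(Rintegral _ _ _).
rewrite RintegralB//; last first.
- exact: (@continuous_itv_integrable _ _ 0 (2 * pi) cl).
- apply: (@continuous_itv_integrable _ (cst (ln 3)) 0 (2 * pi)) => t.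
  exact: cvg_cst.
rewrite Rintegral_ln_expi_sub// subr0.
rewrite [LHS](Rintegral_cst mu mD (ln 3)) mulrC; congr (_ * _).
by rewrite [X in fine X](circle_measure R).
Qed.

(** Divided by r, the right-hand side is |e^(it) - b|^2 plus a term independent of
    t that tends to 0 as r tends to 1, which lets one approach a root b on the
    circle monotonically from inside. *)
Lemma sqr_normc_expi_sub_scale (r : R) b (t : R) : normc b = 1 ->
  normc (expi t - r%:C%C * b) ^+ 2 =
  (1 - r) ^+ 2 + r * normc (expi t - b) ^+ 2.
Proof.
move=> b1; have : Re b ^+ 2 + Im b ^+ 2 = 1 by rewrite -sqr_normcE b1 expr1n.
rewrite !sqr_normcE; case: b {b1} => x y /= xy.
have := cos2Dsin2 t; move: (cos t) (sin t) => c s cs.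
rewrite /= !mul0r subr0 addr0; apply/eqP; rewrite -subr_eq0; apply/eqP.
transitivity ((c ^+ 2 + s ^+ 2 - 1) * (1 - r) +
              (x ^+ 2 + y ^+ 2 - 1) * (r ^+ 2 - r)); first by ring.
by rewrite cs xy; ring.
Qed.

(** Monotone convergence from the roots r_n b with r_n = (n+1) / (n+2), using
    |e^(it) - r_n b|^2 = r_n (|e^(it) - b|^2 + e_n), where
    e_n = (1 - r_n)^2 / r_n = 1 / ((n+1) (n+2)) decreases to 0. *)
Lemma jensen_circle b : normc b = 1 ->
  (\int[mu]_(t in circle) nlog (3^-1 * normc (expi t - b))%R =
   (2 * pi * ln 3)%R%:E)%E.
Proof.
move=> b1; pose r n : R := n.+1%:R / n.+2%:R.
pose e n : R := (n.+1%:R * n.+2%:R)^-1.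
have e0 n : 0 <= e n by rewrite invr_ge0 mulr_ge0.
have e_le n m : (n <= m)%N -> e m <= e n.
  by move=> nm; rewrite lef_pV2 ?posrE ?mulr_gt0// ler_pM// ler_nat.
have r0 n : 0 < r n by rewrite divr_gt0.
have r1 n : r n < 1 by rewrite ltr_pdivrMr// mul1r ltr_nat.
have rb n : normc ((r n)%:C%C * b) < 1.
  rewrite normcM b1 mulr1 /= expr0n addr0 sqrtr_sqr ger0_norm//; exact: ltW.
pose y n t := Num.sqrt (normc (expi t - b) ^+ 2 + e n).
have x2 t : normc (expi t - b) <= 2.
  apply: le_trans (normc_leD _ _) _.
  by rewrite normc_opp normc_expi b1.
have y_gt0 n t : 0 < y n t.
  by rewrite sqrtr_gt0 ltr_wpDl ?sqr_ge0// invr_gt0 mulr_gt0.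
have y_le3 n t : y n t <= 3.
  rewrite -(ler_pXn2r (ltn0Sn 1)) ?nnegrE ?sqrtr_ge0//.
  rewrite sqr_sqrtr ?addr_ge0 ?sqr_ge0//.
  have : normc (expi t - b) ^+ 2 <= 2 ^+ 2.
    by rewrite ler_pXn2r ?nnegrE ?normc_ge0.
  have : e n <= 1.
    by rewrite invf_le1 ?mulr_gt0// -natrM ler1n muln_gt0.
  lra.
have yE n t : normc (expi t - (r n)%:C%C * b) = Num.sqrt (r n) * y n t.
  rewrite -sqrtrM ?(ltW (r0 n))// -[LHS]ger0_norm ?normc_ge0// -sqrtr_sqr.
  rewrite sqr_normc_expi_sub_scale//; congr Num.sqrt.
  rewrite mulrDr addrC; congr (_ + _); rewrite /r /e.
  have n0 : n.+1%:R != 0 :> R by rewrite pnatr_eq0.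
  have n1 : n.+1%:R + 1 != 0 :> R by rewrite natr1 pnatr_eq0.
  rewrite -[n.+2%:R]natr1; move: n.+1%:R n0 n1 => a a0 a1.
  by field; rewrite a0 a1.
pose f n t := nlog (3^-1 * y n t).
have fE n t : (f n t = (ln (Num.sqrt (r n)))%:E +
    nlog (3^-1 * normc (expi t - (r n)%:C%C * b))%R)%E.
  rewrite yE mulrCA nlogM ?sqrtr_ge0 ?mulr_ge0 ?invr_ge0 ?(ltW (y_gt0 n t))//.
  rewrite [X in (_ + (X + _))%E]nlogE ?sqrtr_gt0//.
  by rewrite addeA -EFinD subrr add0e.
have f_ge0 n t : (0 <= f n t)%E.
  by apply: nlog_ge0; rewrite ler_pdivrMl// mulr1.
have mf n : measurable_fun (circle : set R) (f n).
  rewrite (_ : f n = (fun t => (ln (Num.sqrt (r n)))%:E +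
    nlog (3^-1 * normc (expi t - (r n)%:C%C * b))%R)%E); last exact/funext.
  by apply: emeasurable_funD => //; exact: measurable_nlog_sub.
have ge0 (c : R[i]) (t : R) : normc c <= 1 ->
    (0 <= nlog (3^-1 * normc (expi t - c))%R)%E.
  move=> c1; apply: nlog_ge0; rewrite ler_pdivrMl// mulr1.
  apply: le_trans (normc_leD _ _) _.
  by rewrite normc_opp normc_expi -lerBrDl; apply: le_trans c1 _; lra.
have If n : (\int[mu]_(t in circle) f n t =
    (2 * pi * (ln (Num.sqrt (r n)) + ln 3))%R%:E)%E.
  rewrite (@circle_integral_shift _ (ln (Num.sqrt (r n)))
    (fun t => nlog (3^-1 * normc (expi t - (r n)%:C%C * b)))).
  - rewrite (jensen_open_disc (rb n)) -EFinD.
    by rewrite (mulrDr (2 * pi)).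
  - by move=> t _; apply: ge0; exact: ltW.
  - by move=> t _.
  - exact: measurable_nlog_sub.
  - exact: mf.
  - by move=> t _; exact: fE.
have cvgI : (\int[mu]_(t in circle) f n t)%E @[n --> \oo] -->
    (2 * pi * ln 3)%:E.
  under eq_fun do rewrite If.
  apply: cvg_EFin; first exact: nearW.
  have cr : r n @[n --> \oo] --> (1 : R).
    apply: (@squeeze_cvgr _ _ _ _ (fun n => 1 - harmonic n) (cst 1) r).
    - apply: nearW => n; apply/andP; split; last exact: ltW.
      rewrite lerBlDr -lerBlDl.
      have -> : 1 - r n = n.+2%:R^-1.
        rewrite /r -[X in X - _](@divff _ n.+2%:R) ?pnatr_eq0// -mulrBl.
        by rewrite -natrB// subSnn div1r.
      by rewrite lef_pV2 ?posrE// ler_nat.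
    - rewrite -[X in _ --> X]subr0; apply: cvgB; first exact: cvg_cst.
      exact: cvg_harmonic.
    - exact: cvg_cst.
  have cl : ln (Num.sqrt (r n)) @[n --> \oo] --> (0 : R).
    have cs : Num.sqrt (r n) @[n --> \oo] --> (1 : R).
      rewrite -[X in _ --> X]sqrtr1.
      apply: (@cvg_comp _ _ _ r (@Num.sqrt R) \oo (nbhs (1 : R))) => //.
      exact: sqrt_continuous.
    rewrite -[X in _ --> X]ln1.
    apply: (@cvg_comp _ _ _ (fun n => Num.sqrt (r n)) (@ln R) \oo
      (nbhs (1 : R))) => //.
    exact: continuous_ln.
  have cl3 : ln (Num.sqrt (r n)) + ln 3 @[n --> \oo] --> (0 + ln 3 : R).
    by apply: cvgD; [exact: cl|exact: cvg_cst].
  have c2 : 2 * pi * (ln (Num.sqrt (r n)) + ln 3) @[n --> \oo] -->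
      2 * pi * (0 + ln 3 : R).
    by apply: cvgM; [exact: cvg_cst|exact: cl3].
  by move: c2; rewrite add0r.
have mono t : circle t -> {homo f ^~ t : n m / (n <= m)%N >-> (n <= m)%E}.
  move=> _ n m nm; apply: nlog_le; first by rewrite mulr_ge0 ?invr_ge0// ltW.
  by rewrite ler_pM2l ?invr_gt0// ler_wsqrtr// lerD2l e_le.
have mD := @measurable_circle R.
have := @cvg_monotone_convergence _ _ _ mu _ mD f mf
  (fun n t _ => f_ge0 n t) mono.
move=> /(cvg_lim (@ereal_hausdorff R)).
rewrite (cvg_lim (@ereal_hausdorff R) cvgI) => ->.
apply: eq_integral => t _; apply/esym/(cvg_lim (@ereal_hausdorff R)).
apply: (@cvg_nlog _ (fun n => 3^-1 * y n t)).
- by move=> n; rewrite mulr_gt0 ?invr_gt0.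
- by rewrite mulr_ge0 ?invr_ge0 ?normc_ge0.
apply: cvgM; first exact: cvg_cst.
have ce : normc (expi t - b) ^+ 2 + e n @[n --> \oo] -->
    normc (expi t - b) ^+ 2.
  rewrite -[X in _ --> X]addr0; apply: cvgD; first exact: cvg_cst.
  apply: (@squeeze_cvgr _ _ _ _ (cst 0) harmonic e).
  - apply: nearW => n; rewrite e0/= lef_pV2 ?posrE ?mulr_gt0//.
    by rewrite ler_peMr// ler1n.
  - exact: cvg_cst.
  - exact: cvg_harmonic.
rewrite -[X in _ --> X]ger0_norm ?normc_ge0// -sqrtr_sqr.
apply: (@cvg_comp _ _ _ (fun n => normc (expi t - b) ^+ 2 + e n) (@Num.sqrt R)
  \oo (nbhs (normc (expi t - b) ^+ 2))) => //.
exact: sqrt_continuous.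
Qed.

(** For |z| = 1, conj (u z + v) z = conj v z + conj u. *)
Lemma normc_linear_flip (u v : R[i]) (t : R) :
  normc (u * expi t + v) = normc (conjc v * expi t + conjc u).
Proof.
rewrite -[LHS]normc_conj -[LHS]mul1r -(normc_expi t) -normcM; congr normc.
rewrite rmorphD rmorphM mulrDr addrC mulrCA [expi t * _]mulrC.
rewrite (_ : expi t * conjc (expi t) = 1) ?mulr1//.
have := cos2Dsin2 t; rewrite /expi; move: (cos t) (sin t) => c s cs.
by apply/eqP; rewrite eq_complex/= !mulrN opprK -!expr2 cs mulrC addNr !eqxx.
Qed.

(** By the reflection u z + v |-> conj v z + conj u one may assume |v| <= |u|; then
    the root - v / u lies in the closed disc. *)
Lemma jensen_linear (u v : R[i]) : normc u + normc v <= 1 ->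
  0 < Num.max (normc u) (normc v) ->
  (\int[mu]_(t in circle) nlog (normc (u * expi t + v)%R) =
   (2 * pi * - ln (Num.max (normc u) (normc v)))%R%:E)%E.
Proof.
wlog vu : u v / normc v <= normc u => [H|].
  have /orP[vu|uv] := le_total (normc v) (normc u); first exact: H.
  rewrite maxC => uv1 m0; under eq_integral do rewrite normc_linear_flip.
  have := H (conjc v) (conjc u); rewrite !normc_conj maxC; apply => //.
    by rewrite addrC.
  by rewrite maxC.
rewrite max_l// => uv1 u_gt0.
have u0 : u != 0 by rewrite -normc_gt0.
pose b := - (v / u).
have b1 : normc b <= 1.
  by rewrite normc_opp normcM normcV ler_pdivrMr// mul1r.
have lE t : normc (u * expi t + v) = normc u * normc (expi t - b).
  by rewrite -normcM /b opprK mulrDr mulrCA divff// mulr1.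
have Jb : (\int[mu]_(t in circle) nlog (3^-1 * normc (expi t - b))%R =
   (2 * pi * ln 3)%R%:E)%E.
  move: b1; rewrite le_eqVlt => /predU1P[/jensen_circle//|].
  exact: jensen_open_disc.
rewrite (@circle_integral_shift _ (- ln (3 * normc u))
    (fun t => nlog (3^-1 * normc (expi t - b)))).
- rewrite Jb -EFinD; congr EFin.
  by rewrite lnM ?posrE// opprD mulrDr mulrN addrAC addNr add0r.
- move=> t _; apply: nlog_ge0; rewrite ler_pdivrMl// mulr1.
  apply: le_trans (normc_leD _ _) _.
  by rewrite normc_opp normc_expi -lerBrDl; apply: le_trans b1 _; lra.
- move=> t _; apply: nlog_ge0; apply: le_trans (normc_leD _ _) _.
  by rewrite normcM normc_expi mulr1.
- exact: measurable_nlog_sub.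
- have hE t : u * expi t + v = (u *: 'X + v%:P).[expi t] by rewrite !hornerE.
  rewrite (_ : (fun t => _) =
      fun t : R => nlog (1 * normc (u *: 'X + v%:P).[expi t])).
    exact: measurable_nlog_horner.
  by apply/funext => t; rewrite hE mul1r.
- move=> t _; rewrite lE.
  have -> : normc u * normc (expi t - b) =
      (3 * normc u) * (3^-1 * normc (expi t - b)).
    by rewrite mulrACA divff// mul1r.
  by rewrite nlogM ?mulr_ge0 ?normc_ge0// nlogE// mulr_gt0.
Qed.

End jensen.

(** * The polar derivative and products of linear factors *)

(** Polar derivative at degree m, normalized to act as k |-> 2 k - m on the
    monomial of degree k; m may exceed the degree of q. *)
Definition polar (F : nzRingType) (m : nat) (q : {poly F}) : {poly F} :=
  2 *: ('X * deriv q) - m%:R *: q.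

(** The pair (u, v) stands for the form u X + v, so (0, 1) is a root at infinity: a
    polynomial of degree at most m is, up to a constant, a product of exactly m
    such forms. *)
Definition linprod (F : nzRingType) (s : seq (F * F)) : {poly F} :=
  \prod_(x <- s) (x.1 *: 'X + x.2%:P).

Section polar_algebra.
Context {F : fieldType}.
Implicit Types (s : seq (F * F)) (q : {poly F}) (z : F).

Lemma coef_polar m q k : (polar m q)`_k = (k%:R *+ 2 - m%:R) * q`_k.
Proof.
rewrite /polar coefB !coefZ coefXM mulrBl; congr (_ - _).
case: k => [|k] /=; first by rewrite mulr0 mul0rn mul0r.
by rewrite coef_deriv -(mulr_natl q`_k.+1) mulrA mulr_natl.
Qed.

Lemma polarZ m (c : F) q : polar m (c *: q) = c *: polar m q.
Proof.
by apply/polyP => k; rewrite coefZ !coef_polar coefZ mulrCA.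
Qed.

Lemma polarD m q r : polar m (q + r) = polar m q + polar m r.
Proof. by apply/polyP => k; rewrite coefD !coef_polar coefD mulrDr. Qed.

(** Leibniz rule for the polar derivatives of degrees 1 and m, the polar derivative
    of u X + v at degree 1 being u X - v. *)
Lemma polar_linM m (x : F * F) q :
  polar m.+1 ((x.1 *: 'X + x.2%:P) * q) =
  (x.1 *: 'X - x.2%:P) * q + (x.1 *: 'X + x.2%:P) * polar m q.
Proof.
rewrite /polar derivM derivD derivZ derivX derivC addr0 -!mul_polyC.
rewrite !polyC_natr -[m.+1%:R]natr1.
move: (x.1%:P) (x.2%:P) (deriv q) (m%:R) => a b q' M.
ring.
Qed.

Lemma linprod_cons x s :
  linprod (x :: s) = (x.1 *: 'X + x.2%:P) * linprod s.
Proof. by rewrite /linprod big_cons. Qed.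

Lemma linprod_perm s1 s2 : perm_eq s1 s2 -> linprod s1 = linprod s2.
Proof. exact: perm_big. Qed.

Lemma horner_linprod s z :
  (linprod s).[z] = \prod_(x <- s) (x.1 * z + x.2).
Proof.
rewrite /linprod horner_prod; apply: eq_bigr => x _.
by rewrite !hornerE.
Qed.

Lemma horner_polar_linprod s z :
  all (fun x => x.1 * z + x.2 != 0) s ->
  (polar (size s) (linprod s)).[z] =
  (linprod s).[z] * \sum_(x <- s) (x.1 * z - x.2) / (x.1 * z + x.2).
Proof.
elim: s => [_|x s ih /= /andP[x0 /ih {}ih]].
  rewrite big_nil mulr0 /polar /linprod big_nil (derivC 1) mulr0 scaler0.
  by rewrite mulr0n scale0r subrr horner0.
rewrite linprod_cons [size _]/= polar_linM big_cons.
rewrite hornerD 3!hornerM ih.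
have -> : (x.1 *: 'X - x.2%:P).[z] = x.1 * z - x.2 by rewrite !hornerE.
have -> : (x.1 *: 'X + x.2%:P).[z] = x.1 * z + x.2 by rewrite !hornerE.
move: (linprod s).[z] (\sum_(_ <- _) _) (_ - _) (_ + _) x0 => L S A B B0.
by field.
Qed.

Lemma size_linprod s : (size (linprod s) <= (size s).+1)%N.
Proof.
elim: s => [|x s ih]; first by rewrite /linprod big_nil size_poly1.
rewrite linprod_cons; apply: leq_trans (size_polyMleq _ _) _.
have : (size (x.1 *: 'X + x.2%:P)%R <= 2)%N.
  apply: leq_trans (size_polyD _ _) _; rewrite geq_max.
  rewrite (leq_trans (size_scale_leq _ _)) ?size_polyX//.
  by rewrite (leq_trans (size_polyC_leq1 _)).
by move=> hx; rewrite -subn1 leq_subLR (leq_trans (leq_add hx ih)).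
Qed.

Lemma coef_linprod_size s : (linprod s)`_(size s) = \prod_(x <- s) x.1.
Proof.
elim: s => [|x s ih]; first by rewrite /linprod !big_nil coefC.
rewrite linprod_cons big_cons mulrDl coefD -scalerAl coefZ coefXM/= ih.
rewrite mul_polyC coefZ [(linprod s)`_(size s).+1]nth_default.
  by rewrite mulr0 addr0.
exact: size_linprod.
Qed.

End polar_algebra.

(** * Reflecting roots into the closed disc *)

Section flip.
Context {R : realType}.
Local Notation C := R[i].
Implicit Types (x : C * C) (s : seq (C * C)) (z w v : C).

(** Moves the root - x.2 / x.1 into the closed disc by inversion in the circle, if
    it is not there already. *)
Definition flip x : C * C :=
  if normc x.2 <= normc x.1 then x else (conjc x.2, conjc x.1).

Lemma flip_le x : normc (flip x).2 <= normc (flip x).1.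
Proof.
by rewrite /flip; case: ifPn => //=; rewrite !normc_conj -ltNge => /ltW.
Qed.

Lemma normc_flip1 x : normc (flip x).1 = Num.max (normc x.1) (normc x.2).
Proof.
rewrite /flip; case: ifPn => [h|]; first by rewrite max_l.
by rewrite -ltNge /= normc_conj => /ltW h; rewrite max_r.
Qed.

Lemma normc_flip_horner x (t : R) :
  normc ((flip x).1 * expi t + (flip x).2) = normc (x.1 * expi t + x.2).
Proof. by rewrite /flip; case: ifP => //= _; rewrite -normc_linear_flip. Qed.

Lemma normc_flip_hornerN x (t : R) :
  normc ((flip x).1 * expi t - (flip x).2) = normc (x.1 * expi t - x.2).
Proof.
rewrite /flip; case: ifP => //= _.
rewrite -[LHS]normc_opp opprB addrC -mulNr -(rmorphN (@conjc R)).
by rewrite -normc_linear_flip.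
Qed.

(** The real part is the quantity whose sign tells on which side of the circle the
    root lies. *)
Lemma Re_cayley w v : Re ((w - v) / (w + v)) =
  (normc w ^+ 2 - normc v ^+ 2) / normc (w + v) ^+ 2.
Proof.
rewrite !sqr_normcE; case: w v => [a b] [c d] /=.
by rewrite mulrN -mulNr; ring.
Qed.

Lemma Im_cayley w v : Im ((w - v) / (w + v)) =
  2 * Im (w * conjc v) / normc (w + v) ^+ 2.
Proof.
rewrite !sqr_normcE; case: w v => [a b] [c d] /=.
by ring.
Qed.

Lemma Re_cayley_flip x (t : R) :
  Re (((flip x).1 * expi t - (flip x).2) / ((flip x).1 * expi t + (flip x).2)) =
  `|Re ((x.1 * expi t - x.2) / (x.1 * expi t + x.2))|.
Proof.
rewrite !Re_cayley normc_flip_horner normrM normfV; congr (_ / _); last first.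
  by rewrite ger0_norm// sqr_ge0.
rewrite !normcM !normc_expi !mulr1 /flip; case: ifPn => /=.
  by move=> h; rewrite ger0_norm// subr_ge0 ler_pXn2r ?nnegrE ?normc_ge0.
rewrite -ltNge !normc_conj => /ltW h.
by rewrite ler0_norm ?opprB// subr_le0 ler_pXn2r ?nnegrE ?normc_ge0.
Qed.

Lemma Im_cayley_flip x (t : R) :
  Im (((flip x).1 * expi t - (flip x).2) / ((flip x).1 * expi t + (flip x).2)) =
  Im ((x.1 * expi t - x.2) / (x.1 * expi t + x.2)).
Proof.
rewrite !Im_cayley normc_flip_horner; congr (_ * _ / _).
by rewrite /flip; case: ifP => //= _; rewrite conjcK; congr Im; ring.
Qed.

Lemma normc_sum_le (I : Type) (r : seq I) (F G : I -> C) :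
  (forall i, Re (G i) = `|Re (F i)|) -> (forall i, Im (G i) = Im (F i)) ->
  normc (\sum_(i <- r) F i) <= normc (\sum_(i <- r) G i).
Proof.
move=> hR hI.
have ReD (f : I -> C) : Re (\sum_(i <- r) f i) = \sum_(i <- r) Re (f i).
  by elim/big_ind2: _ => // a [b c] d [e f'] /= -> ->.
have ImD (f : I -> C) : Im (\sum_(i <- r) f i) = \sum_(i <- r) Im (f i).
  by elim/big_ind2: _ => // a [b c] d [e f'] /= -> ->.
rewrite -(ler_pXn2r (ltn0Sn 1)) ?nnegrE ?normc_ge0// !sqr_normcE !ReD !ImD.
under [X in _ <= _ + X ^+ 2]eq_bigr do rewrite hI.
rewrite lerD2r -real_normK ?num_real//.
rewrite ler_pXn2r ?nnegrE ?normr_ge0//.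
  by under [leRHS]eq_bigr do rewrite hR; exact: ler_norm_sum.
by apply: sumr_ge0 => i _; rewrite hR.
Qed.

Lemma normc_prod (I : Type) (r : seq I) (F : I -> C) :
  normc (\prod_(i <- r) F i) = \prod_(i <- r) normc (F i).
Proof.
elim: r => [|a r ih]; first by rewrite !big_nil; exact: normc1.
by rewrite !big_cons normcM ih.
Qed.

Lemma normc_linprod_flip s (t : R) :
  normc (linprod [seq flip x | x <- s]).[expi t] = normc (linprod s).[expi t].
Proof.
rewrite !horner_linprod !normc_prod big_map.
by apply: eq_bigr => x _; exact: normc_flip_horner.
Qed.

(** Where no factor vanishes, the quotient by the product is a sum whose terms keep
    their imaginary parts and have their real parts replaced by the absolute
    values.  Where a factor vanishes only one term of the Leibniz rule survives,
    and its modulus does not change. *)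
Lemma normc_polar_linprod_flip s (t : R) :
  normc (polar (size s) (linprod s)).[expi t] <=
  normc (polar (size s) (linprod [seq flip x | x <- s])).[expi t].
Proof.
have [nz|/allPn[x xs]] :=
    boolP (all (fun x : C * C => x.1 * expi t + x.2 != 0) s).
  rewrite -{2}(size_map flip) !horner_polar_linprod//; last first.
    rewrite all_map; apply: sub_all nz => x /=.
    by rewrite -!normc_gt0 normc_flip_horner.
  rewrite !normcM normc_linprod_flip; apply: ler_wpM2l; first exact: normc_ge0.
  rewrite big_map; apply: normc_sum_le => x.
    exact: Re_cayley_flip.
  exact: Im_cayley_flip.
rewrite negbK => /eqP x0; have px := perm_to_rem xs.
rewrite (perm_size px) (linprod_perm px) (linprod_perm (perm_map flip px)).
rewrite /= !linprod_cons !polar_linM.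
have x0' : (flip x).1 * expi t + (flip x).2 = 0.
  by apply/eqP; rewrite -normc_eq0 normc_flip_horner x0 normc0.
rewrite !hornerD 4!hornerM.
have lE (y : C * C) : (y.1 *: 'X + y.2%:P).[expi t] = y.1 * expi t + y.2.
  by rewrite !hornerE.
have lNE (y : C * C) : (y.1 *: 'X - y.2%:P).[expi t] = y.1 * expi t - y.2.
  by rewrite !hornerE.
rewrite !lE !lNE x0 x0' !mul0r !addr0 !normcM normc_flip_hornerN.
by rewrite normc_linprod_flip.
Qed.

End flip.

(** * Mahler's inequality for the logarithmic mean *)

Section mahler.
Context {R : realType}.
Local Notation C := R[i].
Local Notation mu := (@lebesgue_measure R).
Implicit Types (x : C * C) (s : seq (C * C)) (z w v : C) (q : {poly C}).

(** For |z| > 1 all the terms (u z - v) / (u z + v) have positive real part, so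
    their sum does not vanish. *)
Lemma polar_linprod_root_le1 s z : (0 < size s)%N ->
  (forall x, x \in s -> x.1 != 0 /\ normc x.2 <= normc x.1) ->
  root (polar (size s) (linprod s)) z -> normc z <= 1.
Proof.
move=> s0 hs; apply: contraTT; rewrite -ltNge => z1.
have lt x : x \in s -> normc x.2 < normc (x.1 * z).
  move=> /hs[x0]; rewrite normcM => /le_lt_trans; apply.
  by rewrite ltr_pMr// normc_gt0.
have nz x : x \in s -> x.1 * z + x.2 != 0.
  move=> /lt xl; rewrite -normc_gt0 -[x.2]opprK.
  apply: lt_le_trans (normc_leB _ _); by rewrite normc_opp subr_gt0.
rewrite rootE horner_polar_linprod; last by apply/allP.
rewrite mulf_neq0//.
  by rewrite horner_linprod prodf_seq_neq0; apply/allP => x xs; exact: nz.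
apply/eqP => /(congr1 (@complex.Re R)).
have -> : Re (\sum_(x <- s) (x.1 * z - x.2) / (x.1 * z + x.2)) =
    \sum_(x <- s) Re ((x.1 * z - x.2) / (x.1 * z + x.2)).
  by elim/big_ind2: _ => // a [b c] d [e f'] /= -> ->.
apply/eqP; rewrite gt_eqF//=.
have pos x : x \in s -> 0 < Re ((x.1 * z - x.2) / (x.1 * z + x.2)).
  move=> xs; rewrite Re_cayley divr_gt0//.
    by rewrite subr_gt0 ltr_pXn2r ?nnegrE ?normc_ge0// lt.
  by rewrite exprn_gt0// normc_gt0 nz.
case: s s0 {hs lt nz} pos => //= x s _ pos; rewrite big_cons.
rewrite ltr_wpDr ?pos ?mem_head// big_seq; apply: sumr_ge0 => y ys.
by rewrite ltW// pos// inE ys orbT.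
Qed.

Lemma circle_measurable_nlog_horner q :
  measurable_fun (circle : set R) (fun t : R => nlog (normc q.[expi t])).
Proof.
rewrite (_ : (fun t => _) = fun t : R => nlog (1 * normc q.[expi t])).
  exact: measurable_nlog_horner.
by apply/funext => t; rewrite mul1r.
Qed.

Lemma normc_linprod_le1 s (t : R) :
  (forall x, x \in s -> normc x.1 + normc x.2 <= 1) ->
  normc (linprod s).[expi t] <= 1.
Proof.
move=> hs; rewrite horner_linprod normc_prod big_seq.
apply: prodr_ile1 => x xs; rewrite normc_ge0/=.
apply: le_trans (normc_leD _ _) _.
by rewrite normcM normc_expi mulr1 hs.
Qed.

Lemma jensen_linprod s :
  (forall x, x \in s -> normc x.1 + normc x.2 <= 1) ->
  (forall x, x \in s -> 0 < Num.max (normc x.1) (normc x.2)) ->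
  (\int[mu]_(t in circle) nlog (normc (linprod s).[expi t]) =
   (2 * pi * - ln (\prod_(x <- s) Num.max (normc x.1) (normc x.2)))%R%:E)%E.
Proof.
elim: s => [_ _|x s ih h1 h0].
  rewrite big_nil ln1 oppr0 mulr0 /linprod big_nil.
  under eq_integral do rewrite hornerC [normc 1]normc1 nlogE// ln1 oppr0.
  by rewrite integral0.
rewrite big_cons; have hsub y : y \in s -> y \in x :: s.
  by move=> ys; rewrite inE ys orbT.
have le1 y : y \in x :: s -> forall t, normc (y.1 * expi t + y.2) <= 1.
  move=> /h1 hy t; apply: le_trans (normc_leD _ _) _.
  by rewrite normcM normc_expi mulr1.
rewrite lnM ?posrE; last 2 first.
- by apply: h0; rewrite mem_head.
- rewrite big_seq; apply: prodr_gt0 => y ys; apply: h0; exact: hsub.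
rewrite opprD (mulrDr (2 * pi)) EFinD -ih; last 2 first.
- by move=> y ys; apply: h1; exact: hsub.
- by move=> y ys; apply: h0; exact: hsub.
rewrite -jensen_linear; last 2 first.
- by apply: h1; rewrite mem_head.
- by apply: h0; rewrite mem_head.
rewrite -ge0_integralD//.
- apply: eq_integral => t _; rewrite -nlogM ?normc_ge0// -normcM.
  by rewrite !horner_linprod big_cons.
- by move=> t _; apply: nlog_ge0; apply: le1; rewrite mem_head.
- have hE t : x.1 * expi t + x.2 = (x.1 *: 'X + x.2%:P).[expi t].
    by rewrite !hornerE.
  rewrite (_ : (fun t => _) =
      fun t : R => nlog (normc (x.1 *: 'X + x.2%:P).[expi t])).
    exact: circle_measurable_nlog_horner.
  by apply/funext => t; rewrite hE.
- move=> t _; apply: nlog_ge0; apply: normc_linprod_le1 => y ys.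
  by apply: h1; exact: hsub.
- exact: circle_measurable_nlog_horner.
Qed.

Lemma normc_nat k : normc (k%:R : C) = k%:R.
Proof.
by rewrite -(rmorph_nat (real_complex R)) /= expr0n addr0 sqrtr_sqr normr_nat.
Qed.

(** The polar derivative is its leading coefficient times a product of X - z with
    |z| <= 1; up to a factor of modulus 1, the constant k turns it into a product
    of the forms (X - z) / 2, each of logarithmic mean log (1/2). *)
Lemma jensen_polar_linprod s : (0 < size s)%N ->
  (forall x, x \in s -> x.1 != 0 /\ normc x.2 <= normc x.1) ->
  let k := (2 ^+ size s * ((size s)%:R * \prod_(x <- s) normc x.1))^-1 in
  (forall t : R, k * normc (polar (size s) (linprod s)).[expi t] <= 1) /\
  (\int[mu]_(t in circle)
     nlog (k * normc (polar (size s) (linprod s)).[expi t])%R =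
   (2 * pi * - ln (2^-1 ^+ size s))%R%:E)%E.
Proof.
move=> s0 hs k; set m := size s; set p := polar m (linprod s).
have Ppos : 0 < \prod_(x <- s) normc x.1.
  by rewrite big_seq; apply: prodr_gt0 => x /hs[x0 _]; rewrite normc_gt0.
pose L : C := m%:R * \prod_(x <- s) x.1.
have normL : normc L = m%:R * \prod_(x <- s) normc x.1.
  by rewrite normcM normc_nat normc_prod.
have L0 : L != 0 by rewrite -normc_gt0 normL mulr_gt0// ltr0n.
have pm : p`_m = L.
  by rewrite coef_polar coef_linprod_size mulr2n addrK.
have sp : size p = m.+1.
  apply/eqP; rewrite eqn_leq; apply/andP; split.
    apply/leq_sizeP => j mj; rewrite coef_polar nth_default ?mulr0//.
    exact: leq_trans (size_linprod s) mj.
  rewrite ltnNge; apply: contra L0 => /leq_sizeP/(_ _ (leqnn m)).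
  by rewrite pm => ->.
have [r pE] := closed_field_poly_normal p.
have lp : lead_coef p = L by rewrite lead_coefE sp.
have sr : size r = m.
  move: (sp); rewrite {1}pE lp size_scale// size_prod_XsubC.
  by case.
have r1 z : z \in r -> normc z <= 1.
  move=> zr; apply: (@polar_linprod_root_le1 s) => //; rewrite -/m -/p pE.
  by rewrite rootZ ?lp// root_prod_XsubC.
pose s' : seq (C * C) := [seq (2^-1, - (z / 2)) | z <- r].
have n2 : normc (2^-1 : C) = 2^-1 by rewrite normcV normc_nat.
have nz2 z : normc (- (z / 2)) = normc z / 2.
  by rewrite normc_opp normcM n2.
have kp t : k * normc p.[expi t] = normc (linprod s').[expi t].
  rewrite {1}pE lp hornerZ normcM horner_prod horner_linprod !normc_prod.
  have -> : \prod_(x <- s') normc (x.1 * expi t + x.2) =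
      2^-1 ^+ m * \prod_(z <- r) normc ('X - z%:P).[expi t].
    rewrite /s' big_map -sr.
    elim: (r) => [|z r' ih]; first by rewrite !big_nil expr0 mulr1.
    rewrite !big_cons ih exprS mulrACA; congr (_ * _).
    by rewrite -n2 -normcM !hornerE mulrBr [2^-1 * z]mulrC.
  rewrite mulrA; congr (_ * _).
  rewrite /k normL invfM exprVn -mulrA mulVf ?mulr1//.
  by rewrite mulf_neq0 ?gt_eqF// ltr0n.
have s'1 x : x \in s' -> normc x.1 + normc x.2 <= 1.
  move=> /mapP[z /r1 zr ->].
  change (normc (2^-1 : C) + normc (- (z / 2)) <= 1); rewrite nz2 n2; lra.
have s'max x : x \in s' -> Num.max (normc x.1) (normc x.2) = 2^-1.
  move=> /mapP[z /r1 zr ->].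
  change (Num.max (normc (2^-1 : C)) (normc (- (z / 2))) = 2^-1).
  rewrite nz2 n2 max_l//.
  by rewrite ler_pdivrMr// mulVf.
split.
  by move=> t; rewrite kp; exact: normc_linprod_le1.
under eq_integral do rewrite kp.
rewrite jensen_linprod//; last by move=> x /s'max ->; rewrite invr_gt0.
congr ((_ * - ln _)%:E).
rewrite big_seq (eq_bigr (fun=> 2^-1)); last by move=> x; exact: s'max.
by rewrite -big_seq big_const_seq count_predT iter_mulr_1 /s' size_map sr.
Qed.

(** The factors X - z are divided by 1 + |z| to be bounded by 1 on the circle, and
    the product is completed by factors (0, 1). *)
Lemma poly_linprod_factor m q : q != 0 -> (size q <= m.+1)%N ->
  exists c s, [/\ q = c *: linprod s, c != 0, size s = m,
    forall x, x \in s -> normc x.1 + normc x.2 <= 1 &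
    forall x, x \in s -> 0 < Num.max (normc x.1) (normc x.2)].
Proof.
move=> q0 sq; have [r qE] := closed_field_poly_normal q.
have sr : (size r <= m)%N.
  by move: sq; rewrite {1}qE size_scale ?lead_coef_eq0// size_prod_XsubC ltnS.
pose d z : C := (1 + normc z)%:C%C.
have d_gt0 z : 0 < 1 + normc z by rewrite ltr_pwDl// normc_ge0.
have nd z : normc (d z) = 1 + normc z.
  by rewrite /= expr0n addr0 sqrtr_sqr gtr0_norm.
have d0 z : d z != 0 by rewrite -normc_gt0 nd.
pose s1 := [seq ((d z)^-1, - (z / d z)) | z <- r].
pose s := s1 ++ nseq (m - size r) (0 : C, 1 : C).
have lE : \prod_(z <- r) ('X - z%:P) = (\prod_(z <- r) d z) *: linprod s.
  rewrite /linprod big_cat/=.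
  have -> : \prod_(x <- nseq (m - size r) (0 : C, 1 : C))
      (x.1 *: 'X + x.2%:P) = 1.
    rewrite big_nseq; elim: (_ - _)%N => //= k ->.
    by rewrite scale0r add0r mulr1.
  rewrite mulr1 big_map; elim: (r) => [|z r' ih].
    by rewrite !big_nil scale1r.
  rewrite !big_cons ih -scalerAr [d z * _]mulrC -scalerA; congr (_ *: _).
  rewrite scalerAl; congr (_ * _).
  rewrite scalerDr scalerA divff// scale1r -mul_polyC -polyCM.
  by rewrite mulrN mulrCA divff// mulr1 polyCN.
have hs x : x \in s -> normc x.1 + normc x.2 <= 1 /\
    0 < Num.max (normc x.1) (normc x.2).
  rewrite mem_cat => /orP[/mapP[z _ ->]|/nseqP[-> _]].
    change (normc (d z)^-1 + normc (- (z / d z)) <= 1 /\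
      0 < Num.max (normc (d z)^-1) (normc (- (z / d z)))).
    rewrite normc_opp normcM normcV nd; split.
      by rewrite -{1}[(1 + _)^-1]mul1r -mulrDl divff// gt_eqF.
    by rewrite lt_max invr_gt0 d_gt0.
  change (normc (0 : C) + normc (1 : C) <= 1 /\
    0 < Num.max (normc (0 : C)) (normc (1 : C))).
  rewrite [normc 0]normc0 [normc 1]normc1 add0r lexx; split => //.
exists (lead_coef q * \prod_(z <- r) d z), s; split.
- by rewrite -scalerA -lE.
- rewrite mulf_neq0 ?lead_coef_eq0// prodf_seq_neq0; apply/allP => z _.
  exact: d0.
- by rewrite size_cat size_map size_nseq subnKC.
- by move=> x /hs[].
- by move=> x /hs[].
Qed.

(** Both sides are made explicit by Jensen's formula, the right-hand side after
    bounding the polar derivative by the one of the reflected product. *)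
Lemma mahler_polar m q (K : R) : (0 < m)%N -> (size q <= m.+1)%N -> 0 < K ->
  (forall t : R, normc q.[expi t] <= K) ->
  (forall t : R, normc (polar m q).[expi t] <= m%:R * K) ->
  (\int[mu]_(t in circle) nlog (K^-1 * normc q.[expi t])%R <=
   \int[mu]_(t in circle)
     nlog ((m%:R * K)^-1 * normc (polar m q).[expi t])%R)%E.
Proof.
move=> m0 sq K0 qK pK.
have mK0 : 0 < m%:R * K by rewrite mulr_gt0 ?ltr0n.
have [->|q0] := eqVneq q 0.
  have -> : polar m (0 : {poly C}) = 0.
    by apply/polyP => k; rewrite coef_polar !coef0 mulr0.
  under eq_integral do rewrite horner0 [normc 0]normc0 mulr0.
  under [X in (_ <= X)%E]eq_integral do rewrite horner0 [normc 0]normc0 mulr0.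
  by [].
have [c [s [qE c0 ss s1 sm]]] := poly_linprod_factor q0 sq.
pose s' := [seq flip x | x <- s].
have ss' : size s' = m by rewrite size_map.
pose M := \prod_(x <- s) Num.max (normc x.1) (normc x.2).
have M0 : 0 < M by rewrite /M big_seq; apply: prodr_gt0.
have ME : \prod_(x <- s') normc x.1 = M.
  by rewrite big_map; apply: eq_bigr => x _; exact: normc_flip1.
have hs' x : x \in s' -> x.1 != 0 /\ normc x.2 <= normc x.1.
  move=> /mapP[y ys ->]; rewrite -normc_gt0 normc_flip1 sm//; split => //.
  by rewrite -normc_flip1 flip_le.
have s'0 : (0 < size s')%N by rewrite ss'.
have [kle1 kI] := jensen_polar_linprod s'0 hs'.
move: kle1 kI; rewrite ss' ME; set k := (_ * _)^-1 => kle1 kI.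
have k0 : 0 < k by rewrite invr_gt0 !mulr_gt0 ?exprn_gt0 ?ltr0n.
have nc0 : 0 < normc c by rewrite normc_gt0.
have -> : (\int[mu]_(t in circle) nlog (K^-1 * normc q.[expi t])%R =
    (2 * pi * - ln (normc c * M / K))%R%:E)%E.
  rewrite (@circle_integral_shift _ (- ln (normc c / K))
     (fun t => nlog (normc (linprod s).[expi t]))).
  - rewrite jensen_linprod// -EFinD -(mulrDr (2 * pi)) -opprD.
    rewrite -lnM ?posrE ?divr_gt0//; congr (_ * - ln _)%:E.
    by rewrite mulrAC.
  - by move=> t _; apply: nlog_ge0; exact: normc_linprod_le1.
  - by move=> t _; apply: nlog_ge0; rewrite ler_pdivrMl// mulr1.
  - exact: circle_measurable_nlog_horner.
  - exact: measurable_nlog_horner.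
  - move=> t _; rewrite qE hornerZ normcM mulrA [K^-1 * _]mulrC.
    rewrite nlogM ?normc_ge0//.
      by rewrite nlogE// divr_gt0.
    by rewrite divr_ge0// ltW.
rewrite (@circle_integral_shift _ (- ln (normc c / (m%:R * K * k)))
     (fun t => nlog (k * normc (polar m (linprod s)).[expi t]))).
- have kle t : k * normc (polar m (linprod s)).[expi t] <=
      k * normc (polar m (linprod s')).[expi t].
    by rewrite ler_pM2l// -ss normc_polar_linprod_flip.
  apply: (@le_trans _ _ ((2 * pi * - ln (normc c / (m%:R * K * k)))%:E +
      \int[mu]_(t in circle)
         nlog (k * normc (polar m (linprod s')).[expi t])%R)%E).
    rewrite kI -EFinD -(mulrDr (2 * pi)) -opprD -lnM ?posrE; last 2 first.
    + by rewrite divr_gt0// mulr_gt0.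
    + by rewrite exprn_gt0// invr_gt0.
    suff -> : normc c / (m%:R * K * k) * 2^-1 ^+ m = normc c * M / K by [].
    rewrite /k exprVn; have : 2 ^+ m != 0 :> R by rewrite expf_neq0.
    move: m0; rewrite -(ltr0n R) => /gt_eqF/negbT.
    move: (m%:R) (2 ^+ m) (gt_eqF M0) (gt_eqF K0).
    move=> m' P /negbT M0' /negbT K0' m'0 P0.
    by field; rewrite P0 K0' M0' m'0.
  apply: leeD2l; apply: ge0_le_integral => //.
  + by move=> t _; apply: nlog_ge0.
  + exact: measurable_nlog_horner.
  + exact: measurable_nlog_horner.
  + move=> t _; apply: nlog_le => //.
    by rewrite mulr_ge0 ?normc_ge0// ltW.
- move=> t _; apply: nlog_ge0; apply: le_trans (kle1 t).
  by rewrite ler_pM2l// -ss normc_polar_linprod_flip.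
- by move=> t _; apply: nlog_ge0; rewrite ler_pdivrMl// mulr1.
- exact: measurable_nlog_horner.
- exact: measurable_nlog_horner.
- move=> t _; rewrite qE polarZ hornerZ normcM.
  have -> : (m%:R * K)^-1 * (normc c * normc (polar m (linprod s)).[expi t]) =
      normc c / (m%:R * K * k) * (k * normc (polar m (linprod s)).[expi t]).
    move: (m%:R * K) (normc (polar _ _).[_]) (gt_eqF mK0) (gt_eqF k0).
    by move=> A B /negbT A0 /negbT k0'; field; rewrite A0 k0'.
  rewrite nlogM; last 2 first.
  + by rewrite divr_ge0 ?normc_ge0// mulr_ge0 ?(ltW mK0) ?(ltW k0).
  + by rewrite mulr_ge0 ?normc_ge0// ltW.
  by rewrite nlogE// divr_gt0// mulr_gt0.
Qed.

End mahler.

(** * From log to its positive part *)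

(** Tonelli's theorem is for integrals over whole spaces; extending f by 0 outside
    the product of D and E reduces integrals over D and E to it. *)
Section tonelli_on_sets.
Context {R : realType}.
Local Notation mu := (@lebesgue_measure R).
Variables (D E : set (measurableTypeR R)) (f : R * R -> \bar R).
Hypotheses (mD : measurable D) (mE : measurable E).
Hypotheses (mf : measurable_fun [set: R * R] f) (f0 : forall z, (0 <= f z)%E).

Let g := f \_ (D `*` E).

Let mg : measurable_fun [set: R * R] g.
Proof.
apply/(measurable_restrictT f (measurableX mD mE)).
exact: measurable_funTS.
Qed.

Let g0 z : (0 <= g z)%E.
Proof. by rewrite /g patchE; case: ifP. Qed.

Let gE x y : g (x, y) = if (x \in D) && (y \in E) then f (x, y) else 0%E.
Proof. by rewrite /g patchE in_setX. Qed.

Let integral_gE x : (\int[mu]_y g (x, y))%E =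
  ((fun x => \int[mu]_(y in E) f (x, y))%E \_ D) x.
Proof.
rewrite patchE; case: ifPn => xD; last first.
  by under eq_integral do rewrite gE (negbTE xD)/=; rewrite integral0.
rewrite [RHS]integral_mkcond; apply: eq_integral => y _.
by rewrite gE xD/= patchE.
Qed.

Let integral_gE' y : (\int[mu]_x g (x, y))%E =
  ((fun y => \int[mu]_(x in D) f (x, y))%E \_ E) y.
Proof.
rewrite patchE; case: ifPn => yE; last first.
  by under eq_integral do rewrite gE (negbTE yE) andbF; rewrite integral0.
rewrite [RHS]integral_mkcond; apply: eq_integral => x _.
by rewrite gE yE/= andbT patchE.
Qed.

Lemma tonelli_set :
  (\int[mu]_(x in D) \int[mu]_(y in E) f (x, y) =
   \int[mu]_(y in E) \int[mu]_(x in D) f (x, y))%E.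
Proof.
rewrite integral_mkcond [RHS]integral_mkcond.
under eq_integral do rewrite -integral_gE.
under [RHS]eq_integral do rewrite -integral_gE'.
exact: (@fubini_tonelli _ _ _ _ _ mu mu).
Qed.

Lemma measurable_integral_set :
  measurable_fun E (fun y => \int[mu]_(x in D) f (x, y))%E.
Proof.
apply/measurable_restrictT => //.
rewrite (_ : _ \_ _ = fun y => \int[mu]_x g (x, y))%E; last exact/funext.
exact: (@measurable_fun_fubini_tonelli_G _ _ _ _ _ mu).
Qed.

End tonelli_on_sets.

Section log_plus.
Context {R : realType}.
Local Notation C := R[i].
Local Notation mu := (@lebesgue_measure R).
Implicit Types (q : {poly C}).

Lemma measurable_normc d (T : measurableType d) (a b : T -> R) :
  measurable_fun [set: T] a -> measurable_fun [set: T] b ->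
  measurable_fun [set: T] (fun z => normc (Complex (a z) (b z))).
Proof.
move=> ma mb; apply: (measurableT_comp (f := @Num.sqrt R)).
  by apply: continuous_measurable_fun; exact: sqrt_continuous.
by apply: measurable_funD; exact: measurable_funX.
Qed.

Lemma measurable_normc_torus q m :
  measurable_fun [set: R * R]
    (fun z : R * R => normc (q.[expi z.1] + expi z.2 * expi z.1 ^+ m)).
Proof.
have [cr ci] := continuous_Re_Im_horner q.
rewrite (_ : (fun _ => _) = fun z : R * R =>
    normc (Complex (Re q.[expi z.1] + cos (z.2 + z.1 *+ m))
                   (Im q.[expi z.1] + sin (z.2 + z.1 *+ m)))); last first.
  apply/funext => z; rewrite -expiMn -expiD /expi.
  by case: (q.[_]).
have marg : measurable_fun [set: R * R] (fun z : R * R => z.2 + z.1 *+ m).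
  apply: measurable_funD; first exact: measurable_snd.
  rewrite (_ : (fun _ => _) = fun z : R * R => z.1 * m%:R).
    by apply: measurable_funM => //; exact: measurable_fst.
  by apply/funext => z; rewrite mulr_natr.
apply: measurable_normc; apply: measurable_funD.
- apply: (measurableT_comp (f := fun t => Re q.[expi t])).
    exact: continuous_measurable_fun.
  exact: measurable_fst.
- apply: (measurableT_comp (f := cos)) => //.
  by apply: continuous_measurable_fun; exact: continuous_cos.
- apply: (measurableT_comp (f := fun t => Im q.[expi t])).
    exact: continuous_measurable_fun.
  exact: measurable_fst.
- apply: (measurableT_comp (f := sin)) => //.
  by apply: continuous_measurable_fun; exact: continuous_sin.
Qed.

Lemma normc_horner_bounded q :
  exists2 K : R, 0 < K & forall t : R, normc q.[expi t] <= K.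
Proof.
exists (1 + \sum_(i < size q) normc q`_i).
  by rewrite ltr_pwDl// sumr_ge0// => i _; exact: normc_ge0.
move=> t; rewrite horner_coef.
apply: (@le_trans _ _ (\sum_(i < size q) normc q`_i)).
  elim/big_ind2: _ => [|x a y b xa yb|i _].
  - by rewrite [normc _]normc0.
  - exact: le_trans (normc_leD _ _) (lerD xa yb).
  - by rewrite normcM normcX normc_expi expr1n mulr1.
by rewrite lerDr.
Qed.

Definition logp (x : R) : R := ln (Num.max 1 x).

Lemma logp_ge0 x : 0 <= logp x.
Proof. by rewrite ln_ge0// le_max lexx. Qed.

Lemma measurable_logp : measurable_fun [set: R] logp.
Proof.
apply: (measurableT_comp (f := @ln R)); first exact: measurable_ln.
by apply: measurable_maxr.
Qed.

Lemma measurable_logp_horner (k : R) q :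
  measurable_fun [set: R] (fun t : R => logp (k * normc q.[expi t])).
Proof.
apply: (measurableT_comp measurable_logp); apply: measurable_funM => //.
by apply: continuous_measurable_fun; exact: continuous_normc_horner.
Qed.

(** Jensen's formula for the linear form e^(imt) w + v in w = e^(iu): the scaling by
    K >= |v| + 1 makes it bounded by 1. *)
Lemma jensen_torus (K : R) (v : C) m (t : R) : normc v + 1 <= K ->
  (\int[mu]_(u in circle) nlog (K^-1 * normc (v + expi u * expi t ^+ m))%R =
   (2 * pi * (ln K - logp (normc v)))%R%:E)%E.
Proof.
move=> vK; have K0 : 0 < K.
  by apply: lt_le_trans vK; rewrite ltr_wpDl// normc_ge0.
have nK : normc (K^-1%:C%C : C) = K^-1.
  by rewrite /= expr0n addr0 sqrtr_sqr gtr0_norm// invr_gt0.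
pose a : C := K^-1%:C%C * expi t ^+ m; pose b : C := K^-1%:C%C * v.
have na : normc a = K^-1 by rewrite normcM normcX normc_expi expr1n mulr1 nK.
have nb : normc b = K^-1 * normc v by rewrite normcM nK.
have abE u : K^-1 * normc (v + expi u * expi t ^+ m) = normc (a * expi u + b).
  by rewrite -nK -normcM mulrDr addrC /a -mulrA [expi t ^+ m * _]mulrC.
under eq_integral do rewrite abE.
have mE : Num.max (normc a) (normc b) = K^-1 * Num.max 1 (normc v).
  by rewrite na nb maxr_pMr ?mulr1// invr_ge0 ltW.
rewrite jensen_linear ?mE; last 2 first.
- by rewrite na nb -{1}[K^-1]mulr1 -mulrDr ler_pdivrMl// mulr1 addrC.
- by rewrite mulr_gt0 ?invr_gt0// lt_max ltr01.
rewrite lnM ?posrE ?invr_gt0// ?lt_max ?ltr01// lnV ?posrE// /logp.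
by rewrite opprD opprK.
Qed.

(** Average of [mahler_polar] for the polynomials q + e^(iu) 'X^m over u, using that
    the polar derivative multiplies 'X^m by m. *)
Lemma circle_logp_polar m q : (0 < m)%N -> (size q <= m.+1)%N ->
  (\int[mu]_(t in circle) (logp (m%:R^-1 * normc (polar m q).[expi t]))%:E <=
   \int[mu]_(t in circle) (logp (normc q.[expi t]))%:E)%E.
Proof.
move=> m0 sq.
have mR0 : 0 < m%:R :> R by rewrite ltr0n.
have [K1 K1_gt0 qK1] := normc_horner_bounded q.
have [K2 K2_gt0 pK2] := normc_horner_bounded (m%:R^-1 *: polar m q).
(* one scaling, uniform in u, for q + e^(iu) 'X^m and its polar derivative *)
pose K := K1 + K2 + 1.
have K0 : 0 < K by rewrite /K !addr_gt0.
pose r := m%:R^-1 *: polar m q.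
have qK t : normc q.[expi t] + 1 <= K.
  by rewrite /K lerD2r (le_trans (qK1 t))// lerDl ltW.
have rK t : normc r.[expi t] + 1 <= K.
  by rewrite /K lerD2r (le_trans (pK2 t))// lerDr ltW.
have nr t : normc r.[expi t] = m%:R^-1 * normc (polar m q).[expi t].
  by rewrite /r hornerZ normcM normcV normc_nat.
pose Q u := q + (expi u)%:P * 'X^m.
have QE u t : (Q u).[expi t] = q.[expi t] + expi u * expi t ^+ m.
  by rewrite /Q !hornerE.
have pQ u : polar m (Q u) = m%:R *: (r + (expi u)%:P * 'X^m).
  rewrite /Q /r polarD scalerDr scalerA divff ?pnatr_eq0 -?lt0n// scale1r.
  congr (_ + _); apply/polyP => k.
  rewrite coef_polar coefZ coefCM coefXn.
  by case: eqP => [->|_]; rewrite ?mulr0// mulr2n addrK.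
have pQE u t : (polar m (Q u)).[expi t] =
    m%:R * (r.[expi t] + expi u * expi t ^+ m).
  by rewrite pQ !hornerE.
have torus_le (v : C) (u t : R) : normc v + 1 <= K ->
    normc (v + expi u * expi t ^+ m) <= K.
  apply: le_trans; apply: le_trans (normc_leD _ _) _.
  by rewrite normcM normcX !normc_expi expr1n mulr1.
pose F (p : {poly C}) (z : R * R) :=
  nlog (K^-1 * normc (p.[expi z.1] + expi z.2 * expi z.1 ^+ m)).
have F0 p : (forall t : R, normc p.[expi t] + 1 <= K) ->
    forall z, (0 <= F p z)%E.
  move=> pK z; apply: nlog_ge0; rewrite ler_pdivrMl// mulr1; exact: torus_le.
have mF p : measurable_fun [set: R * R] (F p).
  apply: (measurableT_comp (f := @nlog R)); first exact: measurable_nlog.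
  by apply: measurable_funM => //; exact: measurable_normc_torus.
have mD := @measurable_circle R.
have step u : (\int[mu]_(t in circle) F q (t, u) <=
               \int[mu]_(t in circle) F r (t, u))%E.
  have := @mahler_polar _ m (Q u) K m0.
  rewrite (_ : (\int[mu]_(t in _) _)%E =
      (\int[mu]_(t in circle) F q (t, u))%E); last first.
    by apply: eq_integral => t _; rewrite /F QE.
  rewrite (_ : (\int[mu]_(t in _) nlog ((m%:R * K)^-1 * _)%R)%E =
      (\int[mu]_(t in circle) F r (t, u))%E); last first.
    apply: eq_integral => t _; rewrite /F pQE normcM normc_nat invfM.
    by rewrite mulrACA mulVf ?mul1r// gt_eqF.
  apply => //.
  - apply: leq_trans (size_polyD _ _) _; rewrite geq_max sq/= mul_polyC.
    by apply: leq_trans (size_scale_leq _ _) _; rewrite size_polyXn.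
  - by move=> t; rewrite QE; exact: torus_le.
  - by move=> t; rewrite pQE normcM normc_nat ler_pM2l//; exact: torus_le.
have Fint p : (forall t : R, normc p.[expi t] + 1 <= K) ->
   (\int[mu]_(u in circle) \int[mu]_(t in circle) F p (t, u) =
    \int[mu]_(t in circle) (2 * pi * (ln K - logp (normc p.[expi t])))%R%:E)%E.
  move=> pK.
  rewrite -(tonelli_set (f := F p) mD mD (mF p) (F0 p pK)).
  by apply: eq_integral => t _; exact: (jensen_torus m t (pK t)).
have : (\int[mu]_(u in circle) \int[mu]_(t in circle) F q (t, u) <=
        \int[mu]_(u in circle) \int[mu]_(t in circle) F r (t, u))%E.
  apply: ge0_le_integral => //.
  - by move=> u _; apply: integral_ge0 => t _; exact: F0.
  - by apply: measurable_integral_set => //; exact: F0.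
  - by apply: measurable_integral_set => //; exact: F0.
rewrite !Fint//.
pose A (p : {poly C}) :=
  (\int[mu]_(t in circle) (2 * pi * (ln K - logp (normc p.[expi t])))%R%:E)%E.
pose B (p : {poly C}) :=
  (\int[mu]_(t in circle) (logp (normc p.[expi t]))%:E)%E.
have pi2 := pi2_gt0 R.
have mL (p : {poly C}) : measurable_fun (circle : set R)
    (fun t => logp (normc p.[expi t])).
  apply: measurable_funTS; have := measurable_logp_horner 1 p.
  by under eq_fun do rewrite mul1r.
(* A p is finite, hence can be subtracted *)
have BE (p : {poly C}) : (forall t : R, normc p.[expi t] + 1 <= K) ->
   ((2 * pi)%R%:E * B p = (2 * pi * (2 * pi * ln K))%R%:E - A p)%E.
  move=> pK.
  have LK t : logp (normc p.[expi t]) <= ln K.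
    rewrite ler_ln ?posrE// ?lt_max ?ltr01// ge_max.
    have := normc_ge0 p.[expi t]; have := pK t; lra.
  have A0 t : (0 <= (2 * pi * (ln K - logp (normc p.[expi t])))%:E)%E.
    by rewrite lee_fin mulr_ge0 ?(ltW pi2)// subr_ge0.
  have AB : (A p + (2 * pi)%R%:E * B p = (2 * pi * (2 * pi * ln K))%R%:E)%E.
    rewrite /A /B -ge0_integralZl_EFin//; last 3 first.
    - by move=> t _; rewrite lee_fin logp_ge0.
    - by apply/measurable_EFinP; exact: mL.
    - exact: ltW.
    rewrite -ge0_integralD//; last 3 first.
    - apply/measurable_EFinP; apply: measurable_funM => //.
      by apply: measurable_funB => //; exact: mL.
    - by move=> t _; rewrite -EFinM lee_fin mulr_ge0 ?logp_ge0// ltW.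
    - apply/measurable_EFinP; apply: measurable_funM => //; exact: mL.
    under eq_integral do rewrite -EFinM -EFinD -(mulrDr (2 * pi)) subrK.
    rewrite integral_cst//; transitivity ((2 * pi * ln K)%:E * (2 * pi)%:E)%E.
      by congr (_ * _)%E; exact: circle_measure.
    by rewrite -EFinM mulrC.
  have Afin : A p \is a fin_num.
    rewrite ge0_fin_numE; last by apply: integral_ge0 => t _; exact: A0.
    apply: (@le_lt_trans _ _ ((2 * pi * (2 * pi * ln K))%R%:E)).
    2: exact: ltry.
    rewrite -AB leeDl// mule_ge0// ?lee_fin ?(ltW pi2)//.
    by apply: integral_ge0 => t _; rewrite lee_fin logp_ge0.
  by rewrite -AB addeC addeK.
rewrite -/(A q) -/(A r) => Aqr.
under eq_integral do rewrite -nr.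
rewrite -/(B r) -/(B q) -(@lee_pmul2l _ (2 * pi)%:E)// ?lte_fin// !BE//.
by rewrite leeD2l// leeN2.
Qed.

End log_plus.

(** * Powers as superpositions of log-plus *)

Section layer_cake.
Context {R : realType}.
Local Notation mu := (@lebesgue_measure R).

(** With y = p x / 2, y <= e^y gives x e^(- p x) <= (2 / p) e^(- p x / 2). *)
Lemma cvg_expR_Mlinear (p a b : R) : 0 < p ->
  expR (- p * x) * (a * x + b) @[x --> +oo] --> 0.
Proof.
move=> p0.
have ce (c : R) : 0 < c -> expR (- c * x) @[x --> +oo] --> 0.
  move=> c0; rewrite (_ : (fun x => expR (- c * x)) =
      (fun z => expR (- z)) \o (fun z => c * z)); last first.
    by apply: eq_fun => x; rewrite mulNr.
  apply: (@cvg_comp _ _ _ _ _ _ (pinfty_nbhs R)); last exact: cvgr_expR.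
  exact: gt0_cvgMry.
have cx : expR (- p * x) * x @[x --> +oo] --> 0.
  apply: (@squeeze_cvgr _ _ _ _ (cst 0)
    (fun x => 2 / p * expR (- (p / 2) * x))).
  - near=> x; have x0 : 0 <= x by near: x; exact: nbhs_pinfty_ge.
    rewrite mulr_ge0 ?expR_ge0//=.
    have -> : - p * x = - (p / 2) * x + - (p / 2 * x) by field.
    rewrite expRD -mulrA mulrC; apply: ler_wpM2r; first exact: expR_ge0.
    have -> : expR (- (p / 2 * x)) * x =
        (2 / p) * ((p / 2 * x) / expR (p / 2 * x)).
      by rewrite expRN; field; rewrite (gt_eqF p0)/= gt_eqF// expR_gt0.
    rewrite ler_piMr ?divr_ge0 ?(ltW p0)// ler_pdivrMr ?expR_gt0// mul1r.
    by apply: le_trans (expR_ge1Dx _); rewrite lerDr.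
  - exact: cvg_cst.
  - rewrite -[X in _ --> X](mulr0 (2 / p)); apply: cvgM; first exact: cvg_cst.
    by apply: ce; rewrite divr_gt0.
rewrite (_ : (fun x => _) =
    fun x => a * (expR (- p * x) * x) + b * expR (- p * x)); last first.
  by apply/funext => x; ring.
have -> : 0 = a * 0 + b * 0 :> R by rewrite !mulr0 addr0.
by apply: cvgD; apply: cvgM => //; [exact: cvg_cst|exact: cvg_cst|exact: ce].
Unshelve. all: by end_near.
Qed.

(** The integrand vanishes for x below v = - log u and is e^(- p x) (x - v) beyond;
    F is a primitive of the latter that tends to 0 at infinity. *)
Lemma layer_cake (p u : R) : 0 < p -> 0 <= u -> u <= 1 ->
  (\int[mu]_(x in `[0%R, +oo[) (expR (- p * x) * logp (expR x * u))%R%:E =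
   (p^-2 * u `^ p)%R%:E)%E.
Proof.
move=> p0; rewrite le_eqVlt => /predU1P[<- _|u0 u1].
  under eq_integral do rewrite mulr0 /logp max_l ?ler01// ln1 mulr0.
  by rewrite integral0 powR0 ?gt_eqF// mulr0.
pose v := - ln u.
have v0 : 0 <= v by rewrite oppr_ge0 ln_le0.
have uE : u = expR (- v) by rewrite opprK lnK.
pose f (x : R) := expR (- p * x) * (x - v).
transitivity (\int[mu]_(x in `[v, +oo[) (f x)%:E)%E.
  rewrite integral_mkcond [RHS]integral_mkcond; apply: eq_integral => x _.
  rewrite !patchE !mem_setE !in_itv/= !andbT.
  have [xv|vx] := ltP x v.
    case: ifP => // x0; rewrite /logp max_l ?ln1 ?mulr0//.
    by rewrite uE -expRD -expR0 ler_expR subr_le0 ltW.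
  rewrite (le_trans v0 vx); congr (_ * _)%:E.
  by rewrite /logp max_r uE -expRD ?expRK// -expR0 ler_expR subr_ge0.
pose F (x : R) := - (expR (- p * x) * (p^-1 * x + (p^-2 - v / p))).
have dF (x : R) : is_derive x (1 : R) F (f x).
  apply: is_derive_eq; rewrite /f /GRing.scale/=.
  by field; rewrite gt_eqF.
have cF : continuous F.
  by move=> x; apply/differentiable_continuous/derivable1_diffP; case: (dF x).
rewrite (@ge0_continuous_FTC2y _ f F v 0).
- rewrite sub0e -EFinN; congr EFin; rewrite /F /powR gt_eqF// opprK.
  rewrite /v mulrNN [RHS]mulrC; congr (_ * _).
  by rewrite mulrC addrC subrK.
- by move=> x vx; rewrite mulr_ge0 ?expR_ge0// subr_ge0.
- apply: continuous_subspaceT => x; apply: cvgM.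
    apply: (@cvg_comp _ _ _ (fun x => - p * x) (@expR R) _ (nbhs (- p * x))).
      by apply: cvgM; [exact: cvg_cst|exact: cvg_id].
    exact: continuous_expR.
  by apply: cvgB; [exact: cvg_id|exact: cvg_cst].
- rewrite -oppr0; apply: cvgN; exact: cvg_expR_Mlinear.
- by move=> x _; case: (dF x).
- by apply: cvg_at_right_filter; exact: cF.
- by move=> x _; rewrite derive1E; case: (dF x).
Qed.

End layer_cake.

(** * The derivative of a Laurent polynomial *)

Section laurent_derivative.

Lemma is_derive_horner (K : numFieldType) (q : {poly K}) (z : K) :
  is_derive z (1 : K) (horner q : K -> K^o) (deriv q).[z].
Proof.
elim/poly_ind: q => [|q c ih].
  rewrite linear0 horner0 (_ : horner 0 = cst 0); first exact: is_derive_cst.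
  by apply/funext => w; rewrite horner0.
rewrite (_ : horner _ = (fun w : K => q.[w] * w : K^o) + cst c); last first.
  by apply/funext => w; rewrite !hornerE fctE.
apply: is_derive_eq; rewrite derivD derivM derivX derivC !hornerE.
by rewrite [q.[z]%:A]mulr1 addrC; congr (_ + _); exact: mulrC.
Qed.

(** T agrees with w^-n q(w) near z, so it has the same derivative; multiplying by
    z^(n+1) clears the denominators. *)
Lemma derive1_laurent (K : numFieldType) (n : nat) (q : {poly K})
    (T : K -> K^o) (z : K) : z != 0 ->
  (forall w, w != 0 -> T w = (w ^+ n)^-1 * q.[w]) ->
  z ^+ n.+1 * derive1 T z = z * (deriv q).[z] - n%:R * q.[z].
Proof.
move=> z0 TE.
have nz : \forall w \near z, w != 0.
  by apply: (@cvgr_neq0 K K^o _ (nbhs z) _ id z) => //; exact: cvg_id.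
have nT : \forall w \near z, (w ^+ n)^-1 * q.[w] = T w :> K^o.
  by apply: filterS nz => w w0; rewrite TE.
have zn0 : z ^+ n != 0 by rewrite expf_neq0.
have dXn : is_derive z (1 : K) (fun w : K => w ^+ n : K^o) (n%:R * z ^+ n.-1).
  have := is_derive_horner 'X^n z; rewrite derivXn hornerMn hornerXn mulr_natl.
  by congr (is_derive _ _ _ _); apply/funext => w; rewrite hornerXn.
have dV : is_derive z (1 : K) (fun w : K => (w ^+ n)^-1 : K^o)
    (- (z ^+ n) ^- 2 * (n%:R * z ^+ n.-1)).
  case: dXn => d1 d2; apply: DeriveDef; first exact: derivableV.
  by rewrite deriveV// d2.
pose dTz : K := (z ^+ n)^-1 * (deriv q).[z] +
  q.[z] * (- (z ^+ n) ^- 2 * (n%:R * z ^+ n.-1)).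
have dT : is_derive z (1 : K) T dTz.
  apply: near_eq_is_derive nT _.
  by apply: is_deriveM; exact: is_derive_horner.
have -> : derive1 T z = dTz by rewrite derive1E; case: dT.
rewrite {dT}/dTz.
case: n zn0 {TE nT dXn dV} => [|n] zn0.
  by rewrite !expr0 expr1 invr1 mul1r mul0r mulr0 mulr0 addr0 mul0r subr0.
rewrite -pred_Sn [z ^+ n.+2]exprS [z ^+ n.+1]exprS.
have zn : z ^+ n != 0 by rewrite expf_neq0.
by field; rewrite zn z0.
Qed.

End laurent_derivative.

(** * The inequality for power means *)

Section power_means.
Context {R : realType}.
Local Notation C := R[i].
Local Notation mu := (@lebesgue_measure R).
Implicit Types (q : {poly C}).

Lemma normc_real (r : R) : normc (r%:C%C : C) = `|r|.
Proof. by rewrite /= expr0n addr0 sqrtr_sqr. Qed.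

(** [layer_cake] under the integral, followed by Tonelli's theorem. *)
Lemma circle_powR_layer (p k : R) q : 0 < p -> 0 <= k ->
  (forall t : R, k * normc q.[expi t] <= 1) ->
  ((p^-2)%R%:E * \int[mu]_(t in circle) ((k * normc q.[expi t]) `^ p)%:E =
   \int[mu]_(x in `[0%R, +oo[) ((expR (- p * x))%:E *
     \int[mu]_(t in circle) (logp (expR x * (k * normc q.[expi t])))%:E))%E.
Proof.
move=> p0 k0 q1.
have mD := @measurable_circle R.
have mE : measurable (`[0%R, +oo[%classic : set (measurableTypeR R)).
  exact: measurable_itv.
have mn : measurable_fun [set: R] (fun t : R => k * normc q.[expi t]).
  apply: measurable_funM => //.
  by apply: continuous_measurable_fun; exact: continuous_normc_horner.
have n0 t : 0 <= k * normc q.[expi t] by rewrite mulr_ge0 ?normc_ge0.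
pose f (z : R * R) :=
  (expR (- p * z.2) * logp (expR z.2 * (k * normc q.[expi z.1])))%:E.
have mf : measurable_fun [set: R * R] f.
  apply/measurable_EFinP; apply: measurable_funM.
    apply: (measurableT_comp (f := fun x => expR (- p * x))).
    2: exact: measurable_snd.
    apply: measurableT_comp; first exact: measurable_expR.
    exact: measurable_funM.
  apply: (measurableT_comp measurable_logp); apply: measurable_funM.
    by apply: measurableT_comp; [exact: measurable_expR|exact: measurable_snd].
  by apply: (measurableT_comp mn); exact: measurable_fst.
have f0 z : (0 <= f z)%E by rewrite lee_fin mulr_ge0 ?expR_ge0 ?logp_ge0.
rewrite -ge0_integralZl_EFin//; last 3 first.
- by move=> t _; rewrite lee_fin powR_ge0.
- apply/measurable_EFinP; apply: measurable_funTS.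
  exact: (measurableT_comp (measurable_powR p) mn).
- by rewrite invr_ge0 exprn_ge0// ltW.
transitivity (\int[mu]_(t in circle) \int[mu]_(x in `[0%R, +oo[) f (t, x))%E.
  by apply: eq_integral => t _; rewrite /f/= layer_cake// -EFinM.
rewrite (tonelli_set (f := f) mD mE mf f0); apply: eq_integral => x _.
rewrite -ge0_integralZl_EFin ?expR_ge0//.
- by move=> t _; rewrite lee_fin logp_ge0.
- apply/measurable_EFinP; apply: measurable_funTS.
  by apply: (measurableT_comp measurable_logp); exact: measurable_funM.
Qed.

(** Since [layer_cake] is limited to [0, 1], q is first divided by a bound K of both
    moduli; for every x >= 0, [circle_logp_polar] then applies to e^x q / K. *)
Lemma circle_powR_polar (p : R) m q :
  0 < p -> (0 < m)%N -> (size q <= m.+1)%N ->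
  (\int[mu]_(t in circle) ((m%:R^-1 * normc (polar m q).[expi t]) `^ p)%:E <=
   \int[mu]_(t in circle) ((normc q.[expi t]) `^ p)%:E)%E.
Proof.
move=> p0 m0 sq.
have mR0 : 0 < m%:R :> R by rewrite ltr0n.
have [K1 K1_gt0 qK1] := normc_horner_bounded q.
have [K2 K2_gt0 pK2] := normc_horner_bounded (m%:R^-1 *: polar m q).
pose K := K1 + K2.
have K0 : 0 < K by rewrite /K !addr_gt0.
have q1 t : K^-1 * normc q.[expi t] <= 1.
  by rewrite ler_pdivrMl// mulr1 (le_trans (qK1 t))// lerDl ltW.
have r1 t : (K^-1 / m%:R) * normc (polar m q).[expi t] <= 1.
  rewrite -mulrA ler_pdivrMl// mulr1; have := pK2 t.
  rewrite hornerZ normcM normcV normc_nat => /le_trans; apply.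
  by rewrite lerDr ltW.
have mpow (k : R) q' : measurable_fun (circle : set R)
    (fun t : R => (k * normc q'.[expi t]) `^ p).
  apply: measurable_funTS; apply: (measurableT_comp (measurable_powR p)).
  apply: measurable_funM => //.
  by apply: continuous_measurable_fun; exact: continuous_normc_horner.
have scaled :
  (\int[mu]_(t in circle)
     (((K^-1 / m%:R) * normc (polar m q).[expi t]) `^ p)%:E <=
   \int[mu]_(t in circle) ((K^-1 * normc q.[expi t]) `^ p)%:E)%E.
  have kr0 : 0 <= K^-1 / m%:R.
    by rewrite divr_ge0 ?invr_ge0 ?(ltW K0) ?(ltW mR0).
  have kq0 : 0 <= K^-1 by rewrite invr_ge0 ltW.
  have p2 : (0 < (p^-2)%R%:E :> \bar R)%E by rewrite lte_fin invr_gt0 exprn_gt0.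
  have cancel (A B A' B' : \bar R) : ((p^-2)%R%:E * A = A' ->
      (p^-2)%R%:E * B = B' -> A' <= B' -> A <= B)%E.
    by move=> <- <-; rewrite lee_pmul2l.
  apply: (cancel _ _ _ _ (circle_powR_layer p0 kr0 r1)
                         (circle_powR_layer p0 kq0 q1)).
  have mint q' (k : R) : measurable_fun (`[0%R, +oo[%classic : set R)
      (fun x : R => (expR (- p * x))%:E *
         \int[mu]_(t in circle) (logp (expR x * (k * normc q'.[expi t])))%:E)%E.
    pose f (z : R * R) := (logp (expR z.2 * (k * normc q'.[expi z.1])))%:E.
    apply: emeasurable_funM.
      apply/measurable_EFinP; apply: measurable_funTS.
      apply: measurableT_comp; first exact: measurable_expR.
      exact: measurable_funM.
    apply: (@measurable_integral_set _ _ _ f) => //.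
      apply/measurable_EFinP; apply: (measurableT_comp measurable_logp).
      apply: measurable_funM.
        apply: measurableT_comp; first exact: measurable_expR.
        exact: measurable_snd.
      apply: measurable_funM => //.
      apply: (measurableT_comp (f := fun t => normc q'.[expi t])).
      2: exact: measurable_fst.
      by apply: continuous_measurable_fun; exact: continuous_normc_horner.
    by move=> z; rewrite lee_fin logp_ge0.
  apply: ge0_le_integral.
  - exact: measurable_itv.
  - move=> x _; apply: mule_ge0; first by rewrite lee_fin expR_ge0.
    by apply: integral_ge0 => t _; rewrite lee_fin logp_ge0.
  - exact: mint.
  - exact: mint.
  - move=> x _; apply: lee_wpmul2l; first by rewrite lee_fin expR_ge0.
    pose c : C := (expR x * K^-1)%:C%C.
    have nc : normc c = expR x * K^-1.
      by rewrite normc_real ger0_norm// mulr_ge0 ?expR_ge0// invr_ge0 ltW.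
    have scq : (size (c *: q) <= m.+1)%N.
      exact: leq_trans (size_scale_leq _ _) sq.
    have := @circle_logp_polar _ m (c *: q) m0 scq.
    set I1 := (X in (X <= _)%E -> _); set I2 := (X in (_ <= X)%E -> _).
    suff [-> ->] : I1 = (\int[mu]_(t in circle)
          (logp (expR x * (K^-1 / m%:R * normc (polar m q).[expi t])))%:E)%E /\
        I2 = (\int[mu]_(t in circle)
          (logp (expR x * (K^-1 * normc q.[expi t])))%:E)%E by [].
    split; apply: eq_integral => t _.
      rewrite polarZ hornerZ normcM nc; congr (logp _)%:E.
      by move: (normc _) => N; ring.
    by rewrite hornerZ normcM nc mulrA.
have unscale (k : R) (a : R -> R) : 0 <= k -> (forall t, 0 <= a t) ->
   measurable_fun circle (fun t => a t `^ p) ->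
   (\int[mu]_(t in circle) ((k * a t) `^ p)%:E =
    (k `^ p)%:E * \int[mu]_(t in circle) (a t `^ p)%:E)%E.
  move=> k0 a0 ma; rewrite -ge0_integralZl_EFin ?powR_ge0//.
  - by apply: eq_integral => t _; rewrite powRM.
  - by move=> t _; rewrite lee_fin powR_ge0.
  - exact/measurable_EFinP.
move: scaled; under eq_integral do rewrite -mulrA.
have Ki0 : 0 <= K^-1 by rewrite invr_ge0 ltW.
have Kp0 : (0 < (K^-1 `^ p)%:E :> \bar R)%E.
  by rewrite lte_fin powR_gt0// invr_gt0.
rewrite (unscale _ (fun t => m%:R^-1 * normc (polar m q).[expi t]) Ki0).
- rewrite (unscale _ (fun t => normc q.[expi t]) Ki0).
  + by rewrite lee_pmul2l.
  + by move=> t; exact: normc_ge0.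
  + rewrite (_ : (fun t => _) = fun t : R => (1 * normc q.[expi t]) `^ p).
      exact: mpow.
    by apply/funext => t; rewrite mul1r.
- by move=> t; rewrite mulr_ge0 ?invr_ge0 ?normc_ge0.
- exact: mpow.
Qed.

End power_means.

Lemma trig_poly_laurent (R : realType) (n : nat) (T : R[i] -> R[i]) :
  trig_poly n T -> exists2 q : {poly R[i]}, (size q <= (2 * n).+1)%N &
    forall z, z != 0 -> T z = (z ^+ n)^-1 * q.[z].
Proof.
move=> [a aT]; exists (\poly_(k < (2 * n).+1) a (k%:Z - n%:Z)).
  exact: size_poly.
move=> z z0; rewrite aT// horner_poly mulr_sumr; apply: eq_bigr => k _.
rewrite mulrCA; congr (_ * _).
by rewrite expfzDr// -exprnN mulrC.
Qed.

Theorem theorem1p3 (R : realType) (n : nat) (hn : (1 <= n)%N)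
    (p : R) (hp : 0 < p) (T : R[i] -> R[i]) (hT : trig_poly n T) :
  (Mp p (cderiv T) <= n%:R%:E * Mp p T)%E.
Proof.
have [q sq TE] := trig_poly_laurent hT.
have m0 : (0 < 2 * n)%N by rewrite muln_gt0.
have nT t : normc (T (expi t)) = normc q.[expi t].
  rewrite TE ?expi_neq0// normcM normcV normcX normc_expi expr1n invr1 mul1r//.
have nT' t : normc (cderiv T (expi t)) =
    n%:R * ((2 * n)%:R^-1 * normc (polar (2 * n) q).[expi t]).
  have E : normc (expi t ^+ n.+1 * cderiv T (expi t)) =
      normc (cderiv T (expi t)).
    by rewrite normcM normcX normc_expi expr1n mul1r.
  rewrite -E [X in normc X](derive1_laurent (expi_neq0 t) TE).
  have -> : (polar (2 * n) q).[expi t] =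
      2 * (expi t * (deriv q).[expi t] - n%:R * q.[expi t]).
    by rewrite /polar hornerD hornerN !hornerZ hornerM hornerX natrM; ring.
  rewrite normcM normc_nat natrM.
  by field; rewrite pnatr_eq0 -lt0n.
have := circle_powR_polar hp m0 sq.
set w := (fun t => (2 * n)%:R^-1 * normc (polar (2 * n) q).[expi t]) => key.
have w0 t : 0 <= w t by rewrite mulr_ge0 ?invr_ge0 ?normc_ge0.
have mw : measurable_fun (`[0, (2 * pi)]%classic : set R) (fun t => w t `^ p).
  apply: measurable_funTS; apply: (measurableT_comp (measurable_powR p)).
  apply: measurable_funM => //.
  by apply: continuous_measurable_fun; exact: continuous_normc_horner.
have c0 : 0 <= (2 * pi)^-1 :> R by rewrite invr_ge0 ltW// pi2_gt0.
set IT := (\int[lebesgue_measure]_(t in `[0%R, (2 * pi)%R])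
  (normc (T (expi t)) `^ p)%:E)%E.
have IT0 : (0 <= IT)%E by apply: integral_ge0 => t _; rewrite lee_fin powR_ge0.
have Ile : (\int[lebesgue_measure]_(t in `[0%R, (2 * pi)%R])
    (normc (cderiv T (expi t)) `^ p)%:E <= (n%:R `^ p)%:E * IT)%E.
  have -> : (\int[lebesgue_measure]_(t in `[0%R, (2 * pi)%R])
      (normc (cderiv T (expi t)) `^ p)%:E = (n%:R `^ p)%:E *
      \int[lebesgue_measure]_(t in `[0%R, (2 * pi)%R]) (w t `^ p)%:E)%E.
    rewrite -ge0_integralZl_EFin ?powR_ge0//.
    - by apply: eq_integral => t _; rewrite nT' powRM ?ler0n ?(w0 t)// EFinM.
    - by move=> t _; rewrite lee_fin powR_ge0.
    - exact/measurable_EFinP.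
  apply: lee_wpmul2l; first by rewrite lee_fin powR_ge0.
  apply: le_trans key _; rewrite le_eqVlt; apply/orP; left; apply/eqP.
  by apply: eq_integral => t _; rewrite nT.
have nE : (n%:R%:E = (n%:R `^ p)%:E `^ p^-1 :> \bar R)%E.
  by rewrite poweR_EFin -powRrM divff ?gt_eqF// powRr1.
rewrite /Mp [X in (_ <= X * _)%E]nE -poweRM ?lee_fin ?powR_ge0 ?mule_ge0//.
apply: gt0_ler_poweR.
- by rewrite invr_ge0 ltW.
- rewrite in_itv/= leey andbT; apply: mule_ge0; first by rewrite lee_fin.
  by apply: integral_ge0 => t _; rewrite lee_fin powR_ge0.
- rewrite in_itv/= leey andbT; apply: mule_ge0.
    by rewrite lee_fin powR_ge0.
  by apply: mule_ge0; first by rewrite lee_fin.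
by rewrite muleCA; apply: lee_wpmul2l.
Qed.
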